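(* Let $m\ge 1$ and $n\ge m$ be integers, let $\lambda$ be a partition with $|\lambda|=n-2i$ for some integer $0\le i\le\lfloor n/2\rfloor$, and let $\mu$ be a partition with $|\mu|=n-m$, no part of which is divisible by $m$. Then $$\chi^{(n)}_\lambda(\mu\cup(m))=\chi^{(n-m)}_{\phi(\lambda)}(\mu),$$ where $\phi$ is either of the operators $-\phi^{(m)}_1+\epsilon_m$ or $-\phi^{(m)}_1+\epsilon_m\phi^{(m)}_0$ (the identity holds for both choices), $\epsilon_m=1$ if $m$ is even and $\epsilon_m=0$ if $m$ is odd. Here $\mu\cup(m)$ is $\mu$ with a part $m$ appended, and $\chi^{(n-m)}_\kappa(\mu)$ is extended linearly in $\kappa$ to $\kappa\in F$, with the convention that it is $0$ for a partition $\kappa$ with $|\kappa|>n-m$.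
   Context: **Operators $\phi^{(m)}_k$.** A maya diagram is a sequence of integers $[x_1,x_2,\ldots]$ with $x_1>x_2>\cdots$ and $x_i=-i$ for all sufficiently large $i$. Maya diagrams correspond bijectively to partitions: $\lambda=(\lambda_1,\ldots,\lambda_l)$ (extended by zeros) corresponds to $[\lambda_1-1,\lambda_2-2,\ldots]$; the same symbol is used for both. $F$ is the $\mathbb{C}$-vector space with basis all maya diagrams (equivalently, all partitions). A charged maya diagram is a strictly decreasing integer sequence with $x_{i+1}=x_i-1$ for all large $i$, and $\tilde F$ is the $\mathbb{C}$-vector space with these as basis. Sequences satisfying the condition at large $i$ but not necessarily decreasing are regarded as elements of $F$ or $\tilde F$ by the rule that swapping two entries changes the sign (a sequence with a repeated entry is zero). For integers $m\ge1$ and $k$, $\phi^{(m)}_k:F\to F$ is the linear operator $$\phi^{(m)}_k([x_1,x_2,\ldots])=\Bigl(\sum_{a_0,\ldots,a_{m-1}}[a_{m-1},\ldots,a_0,x_1,x_2,\ldots]\Bigr)-m,$$ the sum being over all integer $m$-tuples with $a_i\equiv i\pmod m$ and $a_0+\cdots+a_{m-1}=(0+1+\cdots+(m-1))-km$ (finitely many nonzero terms), where ''$-m$'' is the linear operator $[y_1,y_2,\ldots]\mapsto[y_1-m,y_2-m,\ldots]$. **Brauer algebra characters.** For an indeterminate $x$, the Brauer algebra $D_n(x)$ is the $\mathbb{C}(x)$-algebra with basis all perfect matchings (Brauer diagrams) of $2n$ dots arranged in two rows of $n$; the product of diagrams $a$ and $b$ is obtained by stacking $a$ on top of $b$, removing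 closed loops, forgetting the middle row, and multiplying by $x^{\#\text{removed loops}}$. It contains the group algebra of $S_n$: $w\in S_n$ is the diagram connecting the $i$-th bottom dot with the $w(i)$-th top dot. $D_n(x)$ is semisimple and its irreducible representations are indexed in the standard way by the partitions $\lambda$ with $|\lambda|=n-2i$, $0\le i\le\lfloor n/2\rfloor$. $\chi^{(n)}_\lambda$ is the irreducible character indexed by $\lambda$, and $\chi^{(n)}_\lambda(\mu)$ is its value at a permutation of cycle type $\mu$, $|\mu|=n$. The labelling is the one for which the following known Frobenius-type formula holds (Ram): $\chi^{(n)}_\lambda(\mu)$ is the constant term of $A^{\mathrm{br}}_{\mu_1}\cdots A^{\mathrm{br}}_{\mu_l}s_\lambda$, where $A^{\mathrm{br}}_r=p_r+p_r^\perp+\epsilon_r$ acts on symmetric functions, $s_\lambda$ is the Schur function, $p_r$ is multiplication by the $r$-th power sum, $p_r^\perp$ is its adjoint for the Hall inner product ($\langle s_\lambda,s_\mu\rangle=\delta_{\lambda\mu}$), and $\epsilon_r=1$ for $r$ even, $0$ for $r$ odd. *)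

(* Defs.v *)
From HB Require Import structures.
From mathcomp Require Import all_boot all_order all_algebra.
From mathcomp Require Import perm.
From mathcomp Require Import boolp classical_sets fsbigop reals.
From mathcomp Require Import complex.
From mathcomp Require Import mpoly freeg.

Set Implicit Arguments.
Unset Strict Implicit.
Unset Printing Implicit Defensive.

Import GRing.Theory.
Local Open Scope ring_scope.

Record intpart := IntPart {
  parts :> seq nat;
  _ : sorted geq parts && (0%N \notin parts) }.

HB.instance Definition _ := [isSub for parts].
HB.instance Definition _ := [Choice of intpart by <:].

Definition weight (l : intpart) : nat := sumn l.

Definition eps {R : pzRingType} (r : nat) : R := (~~ odd r)%:R.

Definition has_cycle_type n (w : 'S_n) (mu : seq nat) : bool :=
  perm_eq [seq #|B : {set 'I_n}| | B <- enum (porbits w)] mu.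

(* The space F, with basis the partitions; the maya diagram of l is
   [l_1 - 1, l_2 - 2, ...]. *)
Definition fock (C : nzRingType) := {freeg intpart / C}.

Definition ket (C : nzRingType) (l : intpart) : fock C := << (1 : C) *g l >>.

(* The first N entries of the maya diagram of l; for N >= size l the remaining
   entries are - N - 1, - N - 2, ... *)
Definition maya (N : nat) (l : intpart) : seq int :=
  mkseq (fun i => (nth 0%N l i)%:Z - i.+1%:Z) N.

Definition inversions (s : seq int) : nat :=
  (\sum_(i < size s) \sum_(j < size s | i < j) (s`_i < s`_j)%R)%N.

(* A list s of length N stands for the infinite sequence
     s_1, ..., s_N, - N - 1, - N - 2, ...
   The value in F of that sequence is the sign of the sorting permutation
   times the partition whose maya diagram is a rearrangement of it.  There is
   at most one such partition, and none if an entry is repeated (in s, or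
   between s and the tail), in which case the sum is empty. *)
Definition straighten (C : nzRingType) (s : seq int) : fock C :=
  \sum_(l \in [set l : intpart |
                (size l <= size s)%N /\ perm_eq s (maya (size s) l)]%classic)
    (-1) ^+ inversions s *: ket C l.

Definition phi_tuples (m : nat) (k : int) : set {ffun 'I_m -> int} :=
  [set a : {ffun 'I_m -> int} |
    (forall i : 'I_m, (a i = i%:Z %[mod m%:Z])%Z) /\
    \sum_(i < m) a i = \sum_(i < m) i%:Z - k * m%:Z]%classic.
Arguments phi_tuples : clear implicits.

(* [a_(m-1), ..., a_0, x_1, ..., x_N], where N = size l and x is the maya
   diagram of l.  The tail is - N - 1, - N - 2, ..., so that once every entry
   is lowered by m, it is the tail expected by straighten for a list of length
   N + m. *)
Definition phi_sequence (m : nat) (a : {ffun 'I_m -> int}) (l : intpart) :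
    seq int :=
  [seq a (rev_ord i) | i <- enum 'I_m] ++ maya (size l) l.

(* The shift by - m is linear and commutes with straightening, hence it is
   applied to the entries. *)
Definition phi_basis (C : nzRingType) (m : nat) (k : int) (l : intpart) :
    fock C :=
  \sum_(a \in phi_tuples m k)
    straighten C [seq y - m%:Z | y <- phi_sequence a l].

Definition phi (C : nzRingType) (m : nat) (k : int) (v : fock C) : fock C :=
  fglift (phi_basis C m k) v.

Section SymmetricFunctions.

Variable C : comNzRingType.

Definition last_var0 (N : nat) (p : {mpoly C[N.+1]}) : {mpoly C[N]} :=
  p \mPo [tuple if unlift ord_max i is Some j then 'X_j else 0 | i < N.+1].

(* A symmetric function is a compatible family of symmetric polynomials in
   N = 0, 1, 2, ... variables, of bounded degree. *)
Definition symfun_axiom (f : forall N, {mpoly C[N]}) : Prop :=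
  [/\ forall N, f N \is symmetric,
      forall N, last_var0 (f N.+1) = f N
    & exists d, forall N, (msize (f N) <= d)%N].

Record symfun := SymFun {
  sf :> forall N, {mpoly C[N]};
  _ : symfun_axiom sf }.

Lemma symfun_ext (f g : symfun) : (forall N, f N = g N) -> f = g.
Proof.
case: f g => [f hf] [g hg] /= efg.
have {}efg : f = g by apply: functional_extensionality_dep.
by subst g; congr SymFun; apply: Prop_irrelevance.
Qed.

HB.instance Definition _ := gen_eqMixin symfun.
HB.instance Definition _ := gen_choiceMixin symfun.

Fact symfun0_subproof : symfun_axiom (fun N => 0 : {mpoly C[N]}).
Proof.
split=> [N|N|]; first exact: rpred0.
  by rewrite /last_var0 comp_mpoly0.
by exists 0%N => N; rewrite mmeasure0.
Qed.

Fact symfun1_subproof : symfun_axiom (fun N => 1 : {mpoly C[N]}).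
Proof.
split=> [N|N|]; first exact: rpred1.
  by rewrite /last_var0 comp_mpoly1.
by exists 1%N => N; rewrite msize1.
Qed.

Fact symfunD_subproof (f g : symfun) : symfun_axiom (fun N => f N + g N).
Proof.
case: f g => [f [sf cf [d df]]] [g [sg cg [e eg]]] /=; split=> [N|N|].
- exact: rpredD (sf N) (sg N).
- by rewrite /last_var0 comp_mpolyD; congr (_ + _); [exact: cf|exact: cg].
exists (maxn d e) => N; apply: leq_trans (mmeasureD_le _ _ _) _.
by rewrite geq_max !leq_max df eg orbT.
Qed.

Fact symfunZ_subproof (c : C) (f : symfun) : symfun_axiom (fun N => c *: f N).
Proof.
case: f => [f [sf cf [d df]]] /=; split=> [N|N|].
- exact: rpredZ (sf N).
- by rewrite /last_var0 comp_mpolyZ; congr (_ *: _); exact: cf.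
by exists d => N; apply: leq_trans (mmeasureZ_le _ _ _) _.
Qed.

Fact symfunM_subproof (f g : symfun) : symfun_axiom (fun N => f N * g N).
Proof.
case: f g => [f [sf cf [d df]]] [g [sg cg [e eg]]] /=; split=> [N|N|].
- exact: rpredM (sf N) (sg N).
- by rewrite /last_var0 rmorphM /=; congr (_ * _); [exact: cf|exact: cg].
exists (d + e).+1 => N; apply: leq_trans (msizeM_le _ _) _.
by rewrite ltnS leq_add.
Qed.

Definition symfun_zero := SymFun symfun0_subproof.
Definition symfun_one := SymFun symfun1_subproof.
Definition symfun_add f g := SymFun (symfunD_subproof f g).
Definition symfun_scale c f := SymFun (symfunZ_subproof c f).
Definition symfun_opp f := symfun_scale (-1) f.
Definition symfun_mul f g := SymFun (symfunM_subproof f g).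

Fact symfun_addA : associative symfun_add.
Proof. by move=> f g h; apply: symfun_ext => N /=; rewrite addrA. Qed.
Fact symfun_addC : commutative symfun_add.
Proof. by move=> f g; apply: symfun_ext => N /=; rewrite addrC. Qed.
Fact symfun_add0 : left_id symfun_zero symfun_add.
Proof. by move=> f; apply: symfun_ext => N /=; rewrite add0r. Qed.
Fact symfun_addN : left_inverse symfun_zero symfun_opp symfun_add.
Proof. by move=> f; apply: symfun_ext => N /=; rewrite scaleN1r addNr. Qed.

HB.instance Definition _ := GRing.isZmodule.Build symfun
  symfun_addA symfun_addC symfun_add0 symfun_addN.

Fact symfun_mulA : associative symfun_mul.
Proof. by move=> f g h; apply: symfun_ext => N /=; rewrite mulrA. Qed.
Fact symfun_mulC : commutative symfun_mul.
Proof. by move=> f g; apply: symfun_ext => N /=; rewrite mulrC. Qed.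
Fact symfun_mul1 : left_id symfun_one symfun_mul.
Proof. by move=> f; apply: symfun_ext => N /=; rewrite mul1r. Qed.
Fact symfun_mulDl : left_distributive symfun_mul +%R.
Proof. by move=> f g h; apply: symfun_ext => N /=; rewrite mulrDl. Qed.
Fact symfun_oner_neq0 : symfun_one != 0.
Proof.
apply/eqP => /(congr1 (fun f : symfun => f 0%N)) /= /eqP.
by rewrite oner_eq0.
Qed.

HB.instance Definition _ := GRing.Zmodule_isComNzRing.Build symfun
  symfun_mulA symfun_mulC symfun_mul1 symfun_mulDl symfun_oner_neq0.

Fact symfun_scaleA c d f :
  symfun_scale c (symfun_scale d f) = symfun_scale (c * d) f.
Proof. by apply: symfun_ext => N /=; rewrite scalerA. Qed.
Fact symfun_scale1 : left_id 1 symfun_scale.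
Proof. by move=> f; apply: symfun_ext => N /=; rewrite scale1r. Qed.
Fact symfun_scaleDr : right_distributive symfun_scale +%R.
Proof. by move=> c f g; apply: symfun_ext => N /=; rewrite scalerDr. Qed.
Fact symfun_scaleDl f : {morph symfun_scale^~ f : c d / c + d}.
Proof. by move=> c d; apply: symfun_ext => N /=; rewrite scalerDl. Qed.

HB.instance Definition _ := GRing.Zmodule_isLmodule.Build C symfun
  symfun_scaleA symfun_scale1 symfun_scaleDr symfun_scaleDl.

Definition constant_term (f : symfun) : C := (f 0%N)@_0%MM.

(* The family of the sums of r-th powers is not compatible for r = 0, and p_0 is
   set to 0. *)
Fact power_sum_subproof (r : nat) :
  symfun_axiom (fun N => (\sum_(i < N) 'X_i ^+ r) *+ (0 < r)%N : {mpoly C[N]}).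
Proof.
case: r => [|r]; first exact: symfun0_subproof.
split=> [N|N|].
- rewrite mulr1n; apply/issymP => s; rewrite raddf_sum /=.
  rewrite [RHS](reindex_inj (@perm_inj _ s)) /=; apply: eq_bigr => i _.
  by rewrite rmorphXn /= /msym mmapX mmap1U.
- rewrite /last_var0 !mulr1n raddf_sum big_ord_recr /=.
  rewrite !rmorphXn /= comp_mpolyXU -tnth_nth tnth_mktuple unlift_none.
  rewrite expr0n /= addr0.
  apply: eq_bigr => i _; rewrite rmorphXn /= comp_mpolyXU -tnth_nth tnth_mktuple.
  have -> : widen_ord (leqnSn N) i = fintype.lift ord_max i.
    by apply: val_inj; rewrite /= /bump leqNgt ltn_ord add0n.
  by rewrite fintype.liftK.
exists r.+2 => N; rewrite mulr1n.
apply: leq_trans (mmeasure_sum _ _ _ _) _.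
apply/bigmax_leqP => i _; rewrite mpolyXn msizeX mdegMn mdeg1 mul1n.
by [].
Qed.

Definition power_sum (r : nat) : symfun := SymFun (power_sum_subproof r).

(* The determinant of the matrix with entries x_i ^ (a_j + N - 1 - j), with j
   counted from 0. *)
Definition alternant (N : nat) (a : seq nat) : {mpoly C[N]} :=
  \det (\matrix_(i < N, j < N) 'X_i ^+ (nth 0%N a j + rev_ord j)).

(* s_l is the symmetric function which in N >= length l variables is the
   quotient of alternants; this determines it. *)
Definition is_schur (l : intpart) (f : symfun) : Prop :=
  forall N, (size l <= N)%N -> f N * alternant N [::] = alternant N l.

Definition is_hall_product (s : intpart -> symfun)
    (hall : symfun -> symfun -> C) : Prop :=
  [/\ forall g, scalar (hall^~ g),
      forall f, scalar (hall f)
    & forall l k, hall (s l) (s k) = (l == k)%:R].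

Definition is_adjoint (hall : symfun -> symfun -> C) (A B : symfun -> symfun)
    : Prop :=
  forall f g, hall (A f) g = hall f (B g).

(* A^br_r, where pperp r stands for the adjoint of multiplication by p_r. *)
Definition brauer_operator (pperp : nat -> symfun -> symfun) (r : nat)
    (f : symfun) : symfun :=
  power_sum r * f + pperp r f + eps r *: f.

End SymmetricFunctions.

(* The dots of a diagram: inl i is the i-th top dot, inr i the i-th bottom
   dot. *)
Definition dot (n : nat) : finType := ('I_n + 'I_n)%type.

Definition perfect_matching n (d : {set {set dot n}}) : bool :=
  finset.partition d [set: dot n] && [forall B in d, #|B : {set dot n}| == 2].

Definition diagram (n : nat) := {d : {set {set dot n}} | perfect_matching d}.

(* Stacking a on top of b gives a graph on three rows of dots: inl (inl i) is
   in the top row, inl (inr i) in the middle row (the bottom dots of a, which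
   are the top dots of b) and inr i in the bottom row. *)
Definition stacked_dot (n : nat) : finType := (('I_n + 'I_n) + 'I_n)%type.

Definition upper_dot n (x : dot n) : stacked_dot n := inl x.

Definition lower_dot n (x : dot n) : stacked_dot n :=
  match x with inl i => inl (inr i) | inr i => inr i end.

Definition outer_dot n (x : dot n) : stacked_dot n :=
  match x with inl i => inl (inl i) | inr i => inr i end.

Definition stack_edge n (a b : {set {set dot n}}) : rel (stacked_dot n) :=
  fun u v =>
    [exists x, exists y, [&& [set x; y] \in a, u == upper_dot x
                           & v == upper_dot y]]
    || [exists x, exists y, [&& [set x; y] \in b, u == lower_dot x
                              & v == lower_dot y]].

Definition stack n (a b : {set {set dot n}}) : {set {set dot n}} :=
  [set [set x; y] | x in dot n, y in dot n &
    (x != y) && connect (stack_edge a b) (outer_dot x) (outer_dot y)].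

Definition num_loops n (a b : {set {set dot n}}) : nat :=
  n_comp (stack_edge a b)
    [pred u | [forall x, ~~ connect (stack_edge a b) u (outer_dot x)]].

Definition perm_matching n (w : 'S_n) : {set {set dot n}} :=
  [set [set inr i; inl (w i)] | i in 'I_n].

Section BrauerAlgebra.

Variable C : fieldType.

Definition ratfun := {fraction {poly C}}.

Definition ratfun_const (c : C) : ratfun := tofrac c%:P.

Definition brauer (n : nat) := {ffun diagram n -> ratfun^o}.

Definition brauer_perm n (w : 'S_n) : brauer n :=
  [ffun d => (val d == perm_matching w)%:R].

Definition brauer_one (n : nat) : brauer n := brauer_perm 1%g.

(* The product of the diagrams a and b is x ^ num_loops a b times the diagram
   stack a b. *)
Definition brauer_mul n (f g : brauer n) : brauer n :=
  [ffun d => \sum_(a : diagram n)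
             \sum_(b : diagram n | stack (val a) (val b) == val d)
               f a * g b * tofrac 'X ^+ num_loops (val a) (val b)].

Definition is_representation n d (rho : brauer n -> 'M[ratfun]_d) : Prop :=
  [/\ linear rho,
      rho (brauer_one n) = 1%:M
    & forall f g, rho (brauer_mul f g) = rho f *m rho g].

(* rho acts on column vectors, while the subspaces of MathComp are spanned by
   row vectors, hence the transposition. *)
Definition is_irreducible n d (rho : brauer n -> 'M[ratfun]_d) : Prop :=
  (0 < d)%N /\
  forall V : 'M[ratfun]_d, (forall f, stablemx V (rho f)^T) ->
    V = 0 \/ row_full V.

Definition is_irreducible_character n (x : brauer n -> ratfun) : Prop :=
  exists d (rho : brauer n -> 'M[ratfun]_d),
    [/\ is_representation rho, is_irreducible rho & forall f, x f = \tr (rho f)].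

Definition brauer_label (n : nat) (l : intpart) : Prop :=
  exists2 i, (i <= n./2)%N & weight l = (n - i.*2)%N.

(* chi enumerates the irreducible characters of D_n(x), without repetition, by
   the partitions of n, n - 2, n - 4, ... *)
Definition irreducible_labelling n (chi : intpart -> brauer n -> ratfun)
    : Prop :=
  [/\ forall l, brauer_label n l -> is_irreducible_character (chi l),
      forall l k, brauer_label n l -> brauer_label n k -> chi l =1 chi k -> l = k
    & forall x, is_irreducible_character x ->
        exists2 l, brauer_label n l & x =1 chi l].

(* Ram's formula, which fixes the labelling. *)
Definition ram_formula (s : intpart -> symfun C)
    (pperp : nat -> symfun C -> symfun C) n
    (chi : intpart -> brauer n -> ratfun) : Prop :=
  forall (l mu : intpart) (w : 'S_n),
    brauer_label n l -> has_cycle_type w mu ->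
    chi l (brauer_perm w) =
      ratfun_const (constant_term (foldr (brauer_operator pperp) (s l) mu)).

(* The linear extension of the characters of D_n(x) to F, with the convention
   that chi_l is 0 for |l| > n. *)
Definition chi_ext n (chi : intpart -> brauer n -> ratfun) (v : fock C)
    (f : brauer n) : ratfun :=
  \sum_(l <- dom v | (weight l <= n)%N) ratfun_const (coeff l v) * chi l f.

End BrauerAlgebra.

(* Main.v *)
Require Import Defs.
From HB Require Import structures.
From mathcomp Require Import all_boot all_order all_algebra.
From mathcomp Require Import perm.
From mathcomp Require Import boolp classical_sets fsbigop reals.
From mathcomp Require Import complex.
From mathcomp Require Import mpoly freeg.
From mathcomp Require Import functions.
From mathcomp Require Import zify ring.

Set Implicit Arguments.
Unset Strict Implicit.
Unset Printing Implicit Defensive.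

Import Order.TTheory GRing.Theory Num.Theory.
Local Open Scope ring_scope.

(** By the Frobenius-type formula, both characters are constant terms of
    products of the operators A_r = p_r + p_r^perp + eps_r, one for each part r,
    applied to Schur functions.  Identifying the symmetric functions with F, the
    claim becomes an identity of linear functionals on F,

      <0| A_mu A_m = <0| A_mu phi,

    where <0| is the coefficient of the empty partition (the vacuum) and A_mu is
    the product of the A_r over the parts r of mu.

    Linear functionals on F are encoded as functions of integer sequences which
    change sign under a swap of neighbours and do not see the vacuum tail
    (wedge): straighten is the universal one (pairing_straighten).  On
    sequences all operators are sums of elementary moves.  Multiplication by p_r
    raises the entries by r one at a time, its adjoint lowers them, and phi_k
    prepends an m-tuple.  Three facts give the identity.

    - The A_r commute with each other, as p_r commutes with p_q^perp for r <> q
      (raise_lower_comm).  So A_m may be moved next to <0|.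
    - If m does not divide r, phi_k commutes with p_r and p_r^perp.  Indeed, a
      prepended entry a_i shifted by r falls in the residue class of another
      prepended entry a_j, and exchanging the two is a sign-reversing involution
      on the tuples; only the shifts of the other entries survive
      (vertex_antisym, vertex_shift_each).
    - On the vacuum, <0| p_m = 0 for degree reasons, <0| phi_0 = <0|, and
      <0| phi_1 = - <0| p_m^perp.  If prepending a yields the vacuum, then
      a_i <= i for every i, and the sum of the differences i - a_i is k * m; for
      k = 1 this says that a single entry is lowered by m.  As the sum over all
      the ways of lowering one entry, of a or of x, vanishes, the total is minus
      the sum over the entries of x (vertex_vacuum1).

    Hence <0| A_m A_mu = <0| (p_m^perp + eps_m) A_mu = <0| (- phi_1 + eps_m) A_mu,
    in which phi_1 can be moved to the right of A_mu; and phi_0 can be inserted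
    after eps_m in the same way (brauer_functional_recursion).

    To identify p_r and p_r^perp on Schur functions, the rule for p_r s_l is
    read off the quotients of alternants (power_sum_schur).  The Schur functions
    span the symmetric functions (schur_span), so the Hall product is
    nondegenerate, and its values determine p_r^perp; that lowering is adjoint
    to raising is an identity between sums of determinants, as the coefficients
    of straighten are determinants of 0-1 matrices (coeff_shift_adjoint). *)

Local Notation ge_int := (fun x y : int => y <= x).
Local Notation gt_int := (fun x y : int => y < x).

(** * Alternating functions of integer sequences *)

Section Alternating.

Variables (C : numFieldType) (V : lmodType C).
Implicit Types (w : seq int -> V) (s t u v : seq int).

(** The size is fixed, so that determinants of size N, which read only the
    first N entries, qualify. *)
Definition alternating_at (N : nat) w : Prop :=
  forall u x y v, size (u ++ x :: y :: v) = N ->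
    w (u ++ x :: y :: v) = - w (u ++ y :: x :: v).

(** An entry below - N lies in the tail - N - 1, - N - 2, ... that follows a
    list of length N, where it is a repetition. *)
Definition clipped_at (N : nat) w : Prop :=
  forall s, size s = N -> has (fun x => x < - N%:Z) s -> w s = 0.

Lemma alternating_at_cons N w x :
  alternating_at N.+1 w -> alternating_at N (fun s => w (x :: s)).
Proof. by move=> aw u y z v szN; rewrite -!cat_cons aw //= szN. Qed.

Lemma alternating_at_move N w u x v z :
  alternating_at N w -> size (u ++ x :: v ++ z) = N ->
  w (u ++ x :: v ++ z) = (-1) ^+ size v *: w (u ++ v ++ x :: z).
Proof.
move=> aw; elim: v u => [|y v IHv] u szN /=; first by rewrite scale1r.
rewrite aw // -cat_rcons IHv; last first.
  by rewrite -szN !size_cat /= ?size_rcons ?size_cat /= ?size_cat; lia.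
by rewrite cat_rcons exprS -scalerA scaleN1r.
Qed.

Lemma inversions_cons x s :
  inversions (x :: s) = (count (fun y => (x < y)%R) s + inversions s)%N.
Proof.
rewrite /inversions /= big_ord_recl /=; congr (_ + _)%N.
  rewrite big_mkcond big_ord_recl /= add0n -sum1_count (big_nth 0) big_mkord.
  by rewrite [RHS]big_mkcond /=; apply: eq_bigr => i _; rewrite add0n; case: ifP.
apply: eq_bigr => i _; rewrite big_mkcond big_ord_recl /= add0n [RHS]big_mkcond.
by apply: eq_bigr => j _; rewrite /bump /= !add1n ltnS.
Qed.

Lemma sorted_ge_filter (x : int) t : sorted ge_int t ->
  t = filter (fun y => x < y) t ++ filter (fun y => y <= x) t.
Proof.
elim: t => //= y t IHt srt.
have srt' : sorted ge_int t by apply: path_sorted srt.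
case: (ltP x y) => [_|lyx] /=; first by rewrite -IHt.
have allt : all (fun z => z <= y) t.
  by apply: (order_path_min _ srt) => a b c /= ab bc; apply: le_trans bc ab.
have /all_filterP -> : all (fun z => z <= x) t.
  by apply: sub_all allt => z zy; apply: le_trans zy lyx.
rewrite (_ : [seq z <- t | x < z] = [::]) //.
apply/eqP; rewrite -(negbK (_ == _)) -has_filter; apply/hasPn => z /(allP allt) zy.
by rewrite -leNgt; apply: le_trans zy lyx.
Qed.

Lemma sort_ge_cons (x : int) s (t := sort ge_int s) :
  sort ge_int (x :: s) =
  filter (fun y => x < y) t ++ x :: filter (fun y => y <= x) t.
Proof.
have tot : total ge_int by move=> a b; apply: le_total.
have tr : transitive ge_int by move=> a b c /= ab bc; apply: le_trans bc ab.
have asym : antisymmetric ge_int by move=> a b /= /andP[ab ba]; apply/le_anti/andP.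
have srt : sorted ge_int t by apply: sort_sorted.
apply: (sorted_eq tr asym); first exact: sort_sorted.
  rewrite sorted_pairwise // pairwise_cat /= -!sorted_pairwise //.
  rewrite !sorted_filter // andbT; apply/and3P; split=> //.
    apply/allrelP => a b; rewrite mem_filter => /andP[xa _].
    rewrite inE => /predU1P[->|]; first exact: ltW.
    by rewrite mem_filter => /andP[bx _]; apply/ltW/(le_lt_trans bx xa).
  by apply/allP => a; rewrite mem_filter => /andP[].
rewrite perm_sort perm_sym perm_catC /= perm_cons perm_catC.
by rewrite -sorted_ge_filter // perm_sort.
Qed.

(** Insertion sort: the first entry of the list moves past exactly those
    sorted entries that exceed it, which is its contribution to the number
    of inversions. *)
Lemma alternating_at_sort N w s : alternating_at N w -> size s = N ->
  w s = (-1) ^+ inversions s *: w (sort ge_int s).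
Proof.
elim: s N w => [|x s IHs] N w aw szN.
  by rewrite /inversions big_ord0 scale1r.
case: N aw szN => // N aw [szN].
rewrite (IHs N (fun s => w (x :: s))) //; last exact: alternating_at_cons.
have srt : sorted ge_int (sort ge_int s) by apply: sort_sorted => a b; apply: le_total.
rewrite {1}(sorted_ge_filter x srt).
rewrite (@alternating_at_move _ _ [::] _ _ _ aw) /=; last first.
  by rewrite -sorted_ge_filter // size_sort szN.
rewrite scalerA -exprD inversions_cons sort_ge_cons.
by rewrite addnC size_filter count_sort.
Qed.

Lemma alternating_at_perm_eq0 N w s t : alternating_at N w -> size s = N ->
  perm_eq s t -> w t = 0 -> w s = 0.
Proof.
move=> aw szN pst wt0.
have/perm_sortP eqst := pst.
have eq_srt : sort ge_int s = sort ge_int t.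
  apply: eqst => [a b|a b c /= ab bc|a b /= /andP[ab ba]].
  - exact: le_total.
  - exact: le_trans bc ab.
  by apply/le_anti/andP.
rewrite (alternating_at_sort aw szN) eq_srt.
have : w (sort ge_int t) = 0.
  have szt : size t = N by rewrite -(perm_size pst).
  move: wt0; rewrite (alternating_at_sort aw szt) => /eqP.
  by rewrite scaler_eq0 signr_eq0 /= => /eqP.
by move=> ->; rewrite scaler0.
Qed.

(** Bring two equal entries to the front: swapping them gives w = - w, and 2
    is invertible. *)
Lemma alternating_at_dup N w s : alternating_at N w -> size s = N ->
  ~~ uniq s -> w s = 0.
Proof.
move=> aw szN /(uniqPn 0) [i [j [lij ljs eqij]]].
have xs : s`_i \in s by apply: mem_nth; apply: ltn_trans ljs.
pose t := rem s`_i s.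
have xt : s`_i \in t.
  have : (1 < count_mem (s`_i)%R s)%N.
    rewrite -[s in count _ s](cat_take_drop j) count_cat -addn1 leq_add // -has_count has_pred1.
      by rewrite -(nth_take 0 lij) mem_nth // size_take ljs.
    by rewrite eqij (drop_nth 0) // inE eqxx.
  rewrite (seq.permP (perm_to_rem xs)) /= eqxx add1n ltnS -has_count.
  by rewrite has_pred1.
have ps : perm_eq s (s`_i :: s`_i :: rem s`_i t).
  by apply: (perm_trans (perm_to_rem xs)); rewrite perm_cons perm_to_rem.
apply: (alternating_at_perm_eq0 aw szN ps).
have := aw [::] s`_i s`_i (rem s`_i t); rewrite cat0s -(perm_size ps) => /(_ szN) eqN.
have /eqP : 2%:R *: w [:: s`_i, s`_i & rem s`_i t] = 0.
  by rewrite scaler_nat mulr2n {1}eqN addNr.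
by rewrite scaler_eq0 pnatr_eq0 => /eqP.
Qed.

End Alternating.

(** * Maya diagrams *)

Section Maya.

Implicit Types (l k : intpart) (s : seq int).

Lemma size_maya N l : size (maya N l) = N.
Proof. by rewrite size_mkseq. Qed.

Lemma nth_maya N l i : (i < N)%N -> (maya N l)`_i = (nth 0%N l i)%:Z - i.+1%:Z.
Proof. by move=> ltiN; rewrite nth_mkseq. Qed.

Lemma parts_sorted l : sorted geq l.
Proof. by case: l => l /= /andP[]. Qed.

Lemma parts_gt0 l i : (i < size l)%N -> (0 < nth 0%N l i)%N.
Proof.
case: l => l /= /andP[_ l0] lti; rewrite lt0n; apply: contra l0 => /eqP <-.
exact: mem_nth.
Qed.

Lemma parts_nonincreasing l i j : (i <= j)%N -> (nth 0%N l j <= nth 0%N l i)%N.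
Proof.
move=> leij; case: (ltnP j (size l)) => [ltj|lej]; last by rewrite nth_default.
have tr : transitive geq by move=> a b c /= ab bc; apply: leq_trans bc ab.
have lti := leq_ltn_trans leij ltj.
have rfl : reflexive geq by move=> a; apply: leqnn.
exact: (sorted_leq_nth tr rfl 0%N (parts_sorted l) i j lti ltj leij).
Qed.

Lemma intpart_eqP l k : (forall i, nth 0%N l i = nth 0%N k i) -> l = k.
Proof.
move=> eqlk; apply: val_inj => /=.
have eqsz : size l = size k.
  case: (ltngtP (size l) (size k)) => // lt.
    by have := parts_gt0 lt; rewrite -eqlk nth_default.
  by have := parts_gt0 lt; rewrite eqlk nth_default.
by apply: (@eq_from_nth _ 0%N) => // i _; apply: eqlk.
Qed.

Lemma maya_inj N l k : (size l <= N)%N -> (size k <= N)%N ->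
  maya N l = maya N k -> l = k.
Proof.
move=> lN kN eqm; apply: intpart_eqP => i; case: (ltnP i N) => [lti|leN].
  have /(congr1 (fun s => s`_i)) := eqm; rewrite !nth_maya // => /addIr.
  by case.
by rewrite !nth_default //; apply: leq_trans leN.
Qed.

Lemma maya_ge N l x : x \in maya N l -> - N%:Z <= x.
Proof. case/mapP => i; rewrite mem_iota add0n => /andP[_ ltiN] ->; lia. Qed.

Lemma sorted_maya N l : sorted gt_int (maya N l).
Proof.
apply/(sortedP 0); rewrite size_maya => i lti.
rewrite !nth_maya //; last exact: ltn_trans lti.
have := parts_nonincreasing l (leqnSn i); lia.
Qed.

Lemma gt_int_trans : transitive gt_int.
Proof. by move=> a b c /= ab bc; apply: lt_trans bc ab. Qed.

Lemma gt_int_irr : irreflexive gt_int.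
Proof. by move=> a; rewrite ltxx. Qed.

Lemma uniq_maya N l : uniq (maya N l).
Proof. exact: (sorted_uniq gt_int_trans gt_int_irr (sorted_maya N l)). Qed.

Lemma maya_perm_inj N l k : (size l <= N)%N -> (size k <= N)%N ->
  perm_eq (maya N l) (maya N k) -> l = k.
Proof.
move=> lN kN /perm_mem pm; apply: (maya_inj lN kN).
exact: (irr_sorted_eq gt_int_trans gt_int_irr) (sorted_maya _ _) (sorted_maya _ _) pm.
Qed.

Lemma mayaS N l : (size l <= N)%N -> maya N.+1 l = rcons (maya N l) (- N.+1%:Z).
Proof.
move=> lN; rewrite /maya mkseqS; congr rcons.
by rewrite nth_default // sub0r.
Qed.

Lemma nth_filter_pos (p : seq nat) i : sorted geq p ->
  nth 0%N [seq x <- p | (0 < x)%N] i = nth 0%N p i.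
Proof.
elim: p i => // a p IHp i srt /=.
have tr : transitive geq by move=> x y z /= xy yz; apply: leq_trans yz xy.
case: posnP => [a0|_]; last by case: i => //= i; apply: IHp; apply: path_sorted srt.
have p0 : all (fun z => z == 0%N) p.
  by apply: sub_all (order_path_min tr srt) => z /=; rewrite a0 leqn0.
rewrite (_ : filter _ _ = [::]); last first.
  apply/eqP; rewrite -(negbK (_ == _)) -has_filter; apply/hasPn => z /(allP p0).
  by rewrite lt0n negbK.
rewrite nth_nil; case: i => //= i; case: (ltnP i (size p)) => [lt|le].
  by apply/esym/eqP/(allP p0)/mem_nth.
by rewrite nth_default.
Qed.

(** Trailing zeros are dropped, which changes no value of nth with default
    0. *)
Lemma intpart_of_sorted (p : seq nat) : sorted geq p ->
  exists2 l : intpart, (size l <= size p)%N & forall i, nth 0%N l i = nth 0%N p i.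
Proof.
move=> srt; have tr : transitive geq by move=> x y z /= xy yz; apply: leq_trans yz xy.
have hl : sorted geq [seq x <- p | (0 < x)%N] && (0%N \notin [seq x <- p | (0 < x)%N]).
  by rewrite sorted_filter //= mem_filter.
exists (IntPart hl) => [|i] /=; first by rewrite size_filter count_size.
exact: nth_filter_pos.
Qed.

Lemma sorted_gt_le (t : seq int) i j : sorted gt_int t ->
  (i <= j)%N -> (j < size t)%N -> t`_j + (j - i)%:Z <= t`_i.
Proof.
move=> srt; elim: j => [|j IHj] leij ltj; first by move: leij; rewrite leqn0 => /eqP ->; lia.
move: leij; rewrite leq_eqVlt => /predU1P[->|]; first by rewrite subnn addr0.
rewrite ltnS => leij; have {IHj} := IHj leij (ltnW ltj).
have := sortedP 0 srt j ltj => /=.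
rewrite subSn //; lia.
Qed.

(** The decreasing rearrangement t satisfies t_i >= - (i + 1), as its last
    entry is at least - size s and the entries are distinct; the parts are
    the differences t_i + i + 1. *)
Lemma maya_normal_form s :
    uniq s -> all (fun x => - (size s)%:Z <= x) s ->
  exists2 l : intpart, (size l <= size s)%N & perm_eq s (maya (size s) l).
Proof.
move=> us ges; set N := size s.
(* The maya diagram that is looked for. *)
pose t := sort ge_int s.
have szt : size t = N by rewrite size_sort.
have tot : total ge_int by move=> a b; apply: le_total.
have ut : uniq t by rewrite sort_uniq.
have srt : sorted gt_int t.
  apply/(sortedP 0) => i lti; have /= := sortedP 0 (sort_sorted tot s) i lti.
  have : t`_i.+1 != t`_i by rewrite nth_uniq ?(ltnW lti) // eqn_leq ltnn.
  by rewrite -/t /=; lia.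
have tge i : (i < N)%N -> - i.+1%:Z <= t`_i.
  move=> ltiN.
  have N1 : (N.-1 < size t)%N by rewrite szt; lia.
  have leiN1 : (i <= N.-1)%N by lia.
  have := sorted_gt_le srt leiN1 N1.
  have : - N%:Z <= t`_N.-1.
    by apply: (allP ges); rewrite -(mem_sort ge_int); apply: mem_nth.
  lia.
pose p := mkseq (fun i => absz (t`_i + i.+1%:Z)) N.
have srtp : sorted geq p.
  apply/(sortedP 0%N); rewrite size_mkseq => i lti.
  rewrite !nth_mkseq //; last exact: ltn_trans lti.
  have lti' : (i.+1 < size t)%N by rewrite szt.
  have := sorted_gt_le srt (leqnSn i) lti'.
  have := tge i (ltnW lti); have := tge i.+1 lti; rewrite /=; lia.
have [l szl nthl] := intpart_of_sorted srtp.
rewrite size_mkseq in szl; exists l => //.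
suff -> : maya N l = t by rewrite perm_sym perm_sort.
apply: (@eq_from_nth _ 0); first by rewrite size_maya szt.
move=> i; rewrite size_maya => lti; rewrite nth_maya // nthl nth_mkseq //.
have := tge i lti; lia.
Qed.

End Maya.

(** * Straightening as the universal alternating function *)

Section Straighten.

Variable C : numFieldType.
Implicit Types (l k : intpart) (s t u v : seq int).

Lemma straighten_maya s l : (size l <= size s)%N -> perm_eq s (maya (size s) l) ->
  straighten C s = (-1) ^+ inversions s *: ket C l.
Proof.
move=> szl pl; rewrite /straighten (_ : mkset _ = [set l]%classic) ?fsbig_set1 //.
apply/seteqP; split=> k /=; last by move=> ->.
case=> szk pk; apply: (maya_perm_inj szk szl).
by apply: perm_trans pl; rewrite perm_sym.
Qed.

Lemma straighten0 s :
    (forall l, (size l <= size s)%N -> ~~ perm_eq s (maya (size s) l)) ->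
  straighten C s = 0.
Proof.
move=> no; rewrite /straighten; apply: fsbig1 => l [szl pl].
by have := no l szl; rewrite pl.
Qed.

Variant straighten_spec s : fock C -> Prop :=
| StraightenMaya l of (size l <= size s)%N & perm_eq s (maya (size s) l) :
    straighten_spec s ((-1) ^+ inversions s *: ket C l)
| StraightenZero of ~~ (uniq s && all (fun x => - (size s)%:Z <= x) s) :
    straighten_spec s 0.

Lemma straightenP s : straighten_spec s (straighten C s).
Proof.
case: (boolP (uniq s && all (fun x => - (size s)%:Z <= x) s)) => [/andP[us as_]|no].
  have [l szl pl] := maya_normal_form us as_.
  by rewrite (straighten_maya szl pl); exact: StraightenMaya.
rewrite straighten0; first exact: StraightenZero.
move=> l szl; apply: contra no => pl; rewrite (perm_uniq pl) uniq_maya /=.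
by apply/allP => x; rewrite (perm_mem pl) => /maya_ge.
Qed.

Lemma fglift_sum (V : lmodType C) (f : intpart -> V) (v : fock C) :
  fglift f v = \sum_(l <- dom v) coeff l v *: f l.
Proof.
pose F : {additive fock C -> V} :=
  HB.pack (fglift f) (GRing.isAdditive.Build _ _ (fglift f) (lift_is_additive f)).
rewrite -[v in LHS]freeg_sumE; have -> : fglift f = F by [].
by rewrite raddf_sum; apply: eq_bigr => l _; rewrite /= liftU.
Qed.

Lemma fglift_linear (V : lmodType C) (f : intpart -> V) : linear (fglift f : fock C -> V).
Proof.
move=> c u v; pose F : {additive fock C -> V} :=
  HB.pack (fglift f) (GRing.isAdditive.Build _ _ (fglift f) (lift_is_additive f)).
have -> : fglift f = F by [].
rewrite raddfD; congr (_ + _).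
have -> : c *: u = \sum_(l <- dom u) << c * coeff l u *g l >> by [].
rewrite raddf_sum -[u in RHS]freeg_sumE raddf_sum scaler_sumr.
by apply: eq_bigr => l _; rewrite /= !liftU scalerA.
Qed.

HB.instance Definition _ (V : lmodType C) (f : intpart -> V) :=
  GRing.isLinear.Build C (fock C) V _ (fglift f : fock C -> V) (fglift_linear f).

(** Additivity and homogeneity of maps that carry no bundled linear
    structure. *)
Lemma linear_DZ (U W : lmodType C) (h : U -> W) : linear h ->
  {morph h : x y / x + y} * scalable h.
Proof.
move=> lh; pose H : {linear U -> W} := HB.pack h (GRing.isLinear.Build C U W _ h lh).
by split=> [x y|a x]; rewrite -[h]/(H : U -> W) (linearD, linearZ).
Qed.

Lemma linear_fglift (U W : lmodType C) (h : U -> W) (f : intpart -> U) (v : fock C) :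
  linear h -> h (fglift f v) = fglift (h \o f) v.
Proof.
move=> lh; pose H : {linear U -> W} := HB.pack h (GRing.isLinear.Build C U W _ h lh).
rewrite -[h]/(H : U -> W) !fglift_sum linear_sum.
by apply: eq_bigr => l _; rewrite linearZ.
Qed.

Lemma fglift_ket (V : lmodType C) (f : intpart -> V) l : fglift f (ket C l) = f l.
Proof. by rewrite liftU scale1r. Qed.

(** The linear functional on F with the same values as w at the maya
    diagrams. *)
Definition pairing (V : lmodType C) (w : seq int -> V) : fock C -> V :=
  fglift (fun l => w (maya (size l) l)).

HB.instance Definition _ (V : lmodType C) (w : seq int -> V) :=
  GRing.Linear.copy (pairing w) (fglift (fun l => w (maya (size l) l)) : fock C -> V).

(** The universal property. No linear map out of F sees more of an
    alternating function than its values at the maya diagrams, since both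
    sides pick up the same sign under sorting and vanish on the same
    degenerate lists. *)
Lemma straighten_lift_at (V : lmodType C) N (w : seq int -> V) (f : intpart -> V) s :
    alternating_at N w -> clipped_at N w -> size s = N ->
    (forall l, (size l <= N)%N -> f l = w (maya N l)) ->
  fglift f (straighten C s) = w s.
Proof.
move=> aw cw szN fw; case: straightenP => [l|].
  rewrite szN => szl pl; rewrite linearZ /= fglift_ket fw //.
  rewrite (alternating_at_sort aw szN); congr (_ *: w _).
  have tr : transitive ge_int by move=> a b c /= ab bc; apply: le_trans bc ab.
  apply/esym/(@sorted_eq _ ge_int) => //.
  - by move=> a b /= /andP[ab ba]; apply/le_anti/andP.
  - by apply: sort_sorted => a b; apply: le_total.
  - by apply: sub_sorted (sorted_maya N l) => a b; apply: ltW.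
  by rewrite perm_sort.
rewrite negb_and linear0 => /orP[/(alternating_at_dup aw szN) //|].
rewrite -has_predC szN => no; rewrite cw //.
by apply: sub_has no => x /=; rewrite -ltNge.
Qed.

End Straighten.

(** * Linear functionals on the Fock space *)

Section Wedge.

Variable C : numFieldType.

Section WedgeFunctionals.
Variable V : lmodType C.
Implicit Types (w : seq int -> V) (s t u v : seq int) (l k : intpart).

(** Unlike alternating_at, for all lengths at once. *)
Definition alternating w : Prop :=
  forall u x y v, w (u ++ x :: y :: v) = - w (u ++ y :: x :: v).

(** A list s stands for the infinite sequence continued by the tail;
    appending the first entry of that tail does not change the sequence. *)
Definition stable w : Prop := forall s, w (rcons s (- (size s).+1%:Z)) = w s.

Record wedge w : Prop := Wedge { wedge_alt : alternating w; wedge_stable : stable w }.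

Lemma alternatingW N w : alternating w -> alternating_at N w.
Proof. by move=> aw u x y v _; apply: aw. Qed.

Lemma alternating_dup w s : alternating w -> ~~ uniq s -> w s = 0.
Proof. by move=> aw; apply: (alternating_at_dup (alternatingW aw)). Qed.

Lemma alternating_perm0 w s t : alternating w -> perm_eq s t -> w t = 0 -> w s = 0.
Proof. by move=> aw; apply: (alternating_at_perm_eq0 (alternatingW aw)). Qed.

Definition tail (N r : nat) : seq int := mkseq (fun j => - (N + j).+1%:Z) r.

Lemma size_tail N r : size (tail N r) = r.
Proof. by rewrite size_mkseq. Qed.

Lemma tailSr N r : tail N r.+1 = rcons (tail N r) (- (N + r).+1%:Z).
Proof. by rewrite /tail mkseqS. Qed.

Lemma tailS N r : tail N r.+1 = (- N.+1%:Z) :: tail N.+1 r.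
Proof.
rewrite /tail /mkseq /= addn0; congr (_ :: _).
by rewrite (iotaDl 1 0) -map_comp; apply: eq_map => j /=; lia.
Qed.

Lemma mem_tail N r (x : int) :
  (x \in tail N r) = (- (N + r)%:Z <= x) && (x < - N%:Z).
Proof.
apply/mapP/idP => [[j]|H]; first by rewrite mem_iota => ? ->; lia.
exists (absz (x + N.+1%:Z)); last lia.
by rewrite mem_iota; lia.
Qed.

Lemma stable_tail w s r : stable w -> w (s ++ tail (size s) r) = w s.
Proof.
move=> sw; elim: r => [|r IHr]; first by rewrite cats0.
by rewrite tailSr -rcons_cat -{2}(size_tail (size s) r) -size_cat sw IHr.
Qed.

(** Appending enough of the tail makes the low entry occur twice. *)
Lemma wedge_low w s x : wedge w -> x \in s -> x < - (size s)%:Z -> w s = 0.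
Proof.
case=> aw sw xs ltx; rewrite -(@stable_tail w s (absz x) sw); apply: alternating_dup => //.
rewrite cat_uniq !negb_and; apply/orP; right; apply/orP; left; rewrite negbK.
by apply/hasP; exists x => //=; rewrite mem_tail; lia.
Qed.

Lemma wedge_clipped N w : wedge w -> clipped_at N w.
Proof. by move=> ww s szN /hasP[x xs ltx]; apply: (wedge_low ww xs); rewrite szN. Qed.

Lemma maya_tail l N r : (size l <= N)%N -> maya N l ++ tail N r = maya (N + r) l.
Proof.
elim: r => [|r IHr] lN; first by rewrite addn0 cats0.
by rewrite tailSr addnS (mayaS (leq_trans lN (leq_addr r N))) -rcons_cat IHr.
Qed.

Lemma wedge_maya w N l : stable w -> (size l <= N)%N ->
  w (maya N l) = w (maya (size l) l).
Proof.
move=> sw lN; rewrite -{1}(subnKC lN) -maya_tail //.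
by rewrite -{2}(size_maya (size l) l) stable_tail.
Qed.

Lemma pairing_straighten w s : wedge w -> pairing w (straighten C s) = w s.
Proof.
move=> ww; apply: (@straighten_lift_at _ _ (size s)) => // [||l szl].
- exact/alternatingW/wedge_alt.
- exact: wedge_clipped.
by rewrite (wedge_maya (wedge_stable ww)).
Qed.

(** A functional is known from its values at the maya diagrams, because it
    factors through straighten. *)
Lemma wedge_eq w1 w2 : wedge w1 -> wedge w2 ->
  (forall l, w1 (maya (size l) l) = w2 (maya (size l) l)) -> w1 = w2.
Proof.
move=> ww1 ww2 eqw; apply: funext => s.
rewrite -(pairing_straighten s ww1) -(pairing_straighten s ww2).
by rewrite /pairing; congr (fglift _ _); apply: funext.
Qed.

End WedgeFunctionals.

(** A swap of distinct neighbours changes the number of inversions by one;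
    if the neighbours are equal, no maya diagram is a rearrangement of the
    list. *)
Lemma straighten_swap (u : seq int) (x y : int) (v : seq int) :
  straighten C (u ++ x :: y :: v) = - straighten C (u ++ y :: x :: v).
Proof.
have [->|nexy] := eqVneq x y.
  rewrite straighten0 ?oppr0 // => l _; apply/negP => /perm_uniq.
  by rewrite uniq_maya cat_uniq /= inE eqxx !andbF.
have psw : perm_eq (u ++ x :: y :: v) (u ++ y :: x :: v).
  by rewrite perm_cat2l (perm_catCA [:: x] [:: y] v).
have szsw := perm_size psw.
have inv_sw : (-1) ^+ inversions (u ++ x :: y :: v)
    = - (-1) ^+ inversions (u ++ y :: x :: v) :> C.
  elim: u {psw szsw} => [|z u IHu]; last first.
    rewrite !cat_cons !inversions_cons !exprD IHu mulrN.
    by congr (- (_ ^+ _ * _)); rewrite !count_cat /=; congr (_ + _)%N; rewrite addnCA.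
  rewrite /= !inversions_cons /= !exprD.
  by case: (ltgtP x y) nexy => //= _ _; rewrite !expr1 expr0 ?mulN1r ?mul1r ?mulrN ?mulNr ?opprK;
    rewrite mulrCA.
case: (straightenP C (u ++ y :: x :: v)) => [l szl pl|no].
  have pl' := perm_trans psw pl; rewrite -szsw in szl pl'.
  by rewrite (straighten_maya C szl pl') inv_sw scaleNr.
rewrite oppr0 straighten0 // => l; rewrite szsw => szl; apply: contra no => pl.
rewrite -(perm_uniq psw) (perm_uniq pl) uniq_maya /=.
by apply/allP => z; rewrite -(perm_mem psw) (perm_mem pl) => /maya_ge.
Qed.

Lemma straighten_rcons (s : seq int) : straighten C (rcons s (- (size s).+1%:Z)) = straighten C s.
Proof.
set e := - _; have sze : size (rcons s e) = (size s).+1 by rewrite size_rcons.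
case: (straightenP C s) => [l szl pl|no].
  rewrite (@straighten_maya _ (rcons s e) l); last 2 first.
  - by rewrite sze leqW.
  - by rewrite sze mayaS // -!cats1 perm_cat2r.
  congr (_ ^+ _ *: _).
  have : all (fun x => e < x) s.
    by apply/allP => x; rewrite (perm_mem pl) => /maya_ge; rewrite /e; lia.
  elim: (s) => [_|x s' IHs /= /andP[ex es]].
    by rewrite inversions_cons.
  rewrite !inversions_cons IHs // -cats1 count_cat /= addn0.
  by rewrite ltNge (ltW ex) addn0.
rewrite straighten0 // => l; rewrite sze => szl; apply: contra no => pl.
have ge_s x : x \in s -> e <= x.
  move=> xs; have /maya_ge : x \in maya (size s).+1 l.
    by rewrite -(perm_mem pl) mem_rcons inE xs orbT.
  by rewrite /e.
move: (perm_uniq pl); rewrite uniq_maya rcons_uniq => /andP[es us].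
rewrite us; apply/allP => x xs; have := ge_s x xs.
rewrite /e le_eqVlt => /predU1P[exE|]; last by lia.
by move: es; rewrite /e exE xs.
Qed.

Lemma straighten_wedge : wedge (straighten C : seq int -> fock C).
Proof. by split; [exact: straighten_swap | exact: straighten_rcons]. Qed.

Lemma wedge_linear (V V' : lmodType C) (w : seq int -> V) (f : {linear V -> V'}) :
  wedge w -> wedge (f \o w).
Proof.
case=> aw sw; split=> [u x y v|s].
  by rewrite /= (aw u x y v) raddfN.
by rewrite /= (sw s).
Qed.

End Wedge.

(** * Shifting the entries one at a time *)

Section ShiftEach.

Variable V : zmodType.
Implicit Types (w : seq int -> V) (s t u v : seq int) (c d : int).

(** The derivation induced by x |-> x + c: the sum, over the entries of s,
    of the value of w at s with that single entry shifted. The recursion on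
    s peels off the first entry and passes the rest to w with this entry
    fixed. *)
Fixpoint shift_each c w s : V :=
  if s is x :: v then w ((x + c) :: v) + shift_each c (fun t => w (x :: t)) v
  else 0.

Lemma shift_each_cat c w u v :
  shift_each c w (u ++ v) =
    shift_each c (fun t => w (t ++ v)) u + shift_each c (fun t => w (u ++ t)) v.
Proof.
elim: u w => [|x u IHu] w /=; first by rewrite add0r.
by rewrite IHu addrA.
Qed.

Lemma shift_eachD c w1 w2 s :
  shift_each c (fun t => w1 t + w2 t) s = shift_each c w1 s + shift_each c w2 s.
Proof.
elim: s w1 w2 => [|x s IHs] w1 w2 /=; first by rewrite addr0.
by rewrite IHs addrACA.
Qed.

Lemma shift_each0 c s : shift_each c (fun=> 0) s = 0.
Proof. by elim: s => //= x s ->; rewrite addr0. Qed.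

Lemma shift_eachN c w s : shift_each c (fun t => - w t) s = - shift_each c w s.
Proof.
by elim: s w => [|x s IHs] w /=; rewrite ?oppr0 // IHs opprD.
Qed.

Lemma shift_each_sum (I : Type) (r : seq I) (F : I -> seq int -> V) c s :
  shift_each c (fun t => \sum_(i <- r) F i t) s = \sum_(i <- r) shift_each c (F i) s.
Proof.
elim: r => [|i r IHr].
  rewrite big_nil -[RHS](shift_each0 c s); congr (shift_each _ _ _).
  by apply: funext => t; rewrite big_nil.
rewrite big_cons -IHr -shift_eachD; congr (shift_each _ _ _).
by apply: funext => t; rewrite big_cons.
Qed.

Lemma shift_each_eq0 c w s :
  (forall u x v, s = u ++ x :: v -> w (u ++ (x + c) :: v) = 0) ->
  shift_each c w s = 0.
Proof.
elim: s w => //= x s IHs w w0.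
rewrite (w0 [::] x s) // add0r; apply: IHs => u y v eqs.
by apply: (w0 (x :: u)); rewrite eqs.
Qed.

Lemma eq_shift_each c w1 w2 s :
  (forall u x v, s = u ++ x :: v -> w1 (u ++ (x + c) :: v) = w2 (u ++ (x + c) :: v)) ->
  shift_each c w1 s = shift_each c w2 s.
Proof.
elim: s w1 w2 => //= x s IHs w1 w2 eqw.
rewrite (eqw [::] x s) //; congr (_ + _); apply: IHs => u y v eqs.
by apply: (eqw (x :: u)); rewrite eqs.
Qed.

Lemma shift_each_comm c d w s :
  shift_each c (shift_each d w) s = shift_each d (shift_each c w) s.
Proof.
elim: s w => //= x s IHs w; rewrite !shift_eachD IHs addrACA.
by rewrite (addrAC x c d).
Qed.

Lemma shift_each_map c e w s :
  shift_each c (fun t => w [seq y - e | y <- t]) s =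
  shift_each c w [seq y - e | y <- s].
Proof.
elim: s w => //= x s IHs w; rewrite (addrAC x c); congr (_ + _).
exact: (IHs (fun t => w (x - e :: t))).
Qed.

Lemma shift_each_index c w s :
  shift_each c w s = \sum_(i < size s) w (set_nth 0 s i (s`_i + c)).
Proof.
elim: s w => [|x s IHs] w /=; first by rewrite big_ord0.
by rewrite big_ord_recl /= IHs.
Qed.

End ShiftEach.

Section Operators.

Variables (C : numFieldType) (V : lmodType C).
Implicit Types (w : seq int -> V) (s t u v : seq int) (c d : int) (r : nat).

(** Shifts of entries outside the swapped pair commute with the swap, and
    the two shifts inside the pair are exchanged by it. *)
Lemma shift_each_alternating c w : alternating w -> alternating (shift_each c w).
Proof.
move=> aw u x y v; rewrite !shift_each_cat /= !opprD -!shift_eachN.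
congr (_ + _); first by congr (shift_each _ _ _); apply: funext => t; apply: aw.
rewrite addrCA (aw u (x + c)) (aw u x (y + c)); congr (_ + (_ + _)).
by congr (shift_each _ _ _); apply: funext => t; apply: aw.
Qed.

Lemma uniq_middle (T : eqType) (x : T) (p q : seq T) :
  uniq (p ++ x :: q) = (x \notin p ++ q) && uniq (p ++ q).
Proof.
rewrite (perm_uniq (_ : perm_eq _ (x :: p ++ q))) //.
exact/permPl/(perm_catCA p [:: x] q).
Qed.

Lemma linear_shift_each (V' : lmodType C) (h : V -> V') c w s :
  linear h -> h (shift_each c w s) = shift_each c (h \o w) s.
Proof.
move=> lh; pose H : {linear V -> V'} := HB.pack h (GRing.isLinear.Build C V V' _ h lh).
by rewrite -[h]/(H : V -> V') !shift_each_index linear_sum.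
Qed.

(** The transpose of the adjoint of p_r. Only the listed entries are
    lowered: a lowered tail entry meets another tail entry. *)
Definition lower r w := shift_each (- r%:Z) w.

(** The transpose of multiplication by p_r. The first r tail entries may
    rise into the list without meeting another tail entry, so they are
    listed explicitly. *)
Definition raise r w s := shift_each r%:Z w (s ++ tail (size s) r).

Lemma lower_wedge r w : (0 < r)%N -> wedge w -> wedge (lower r w).
Proof.
move=> r0 ww; have [aw sw] := ww; split=> [|s]; first exact/shift_each_alternating/wedge_alt.
rewrite /lower -cats1 shift_each_cat /= addr0.
rewrite [X in _ + X](wedge_low ww (x := - (size s).+1%:Z - r%:Z)).
- by rewrite addr0; apply: eq_shift_each => p x q ->; rewrite cats1 -[RHS]sw !size_cat.
- by rewrite mem_cat inE eqxx orbT.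
- by rewrite size_cat /=; lia.
Qed.

(** A tail entry beyond the first r, once raised by r, coincides with an
    earlier tail entry. *)
Lemma raise_extend r k w s : (0 < r)%N -> wedge w ->
  shift_each r%:Z w (s ++ tail (size s) (r + k)) = raise r w s.
Proof.
move=> r0 ww; have [aw sw] := ww.
elim: k => [|k IHk]; first by rewrite addn0.
rewrite -{}IHk addnS tailSr -rcons_cat.
set t := s ++ _; have szt : size t = (size s + (r + k))%N by rewrite size_cat size_tail.
rewrite -cats1 shift_each_cat /= addr0 [X in _ + X]alternating_dup //.
  rewrite addr0; apply: eq_shift_each => p x q eqt.
  by rewrite cats1 -[RHS]sw !size_cat -szt eqt size_cat.
rewrite cats1 rcons_uniq negb_and negbK; apply/orP; left.
by rewrite /t mem_cat mem_tail; apply/orP; right; lia.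
Qed.

Lemma raise_wedge r w : (0 < r)%N -> wedge w -> wedge (raise r w).
Proof.
move=> r0 ww; have [aw sw] := ww; split=> [u x y v|s].
  rewrite /raise -!catA; have := shift_each_alternating r%:Z aw.
  move/(_ u x y (v ++ tail (size (u ++ x :: y :: v)) r)) => /= ->.
  by rewrite !size_cat.
rewrite -[RHS](raise_extend 1 _ r0 ww) addn1 tailS -cat_rcons.
by rewrite /raise size_rcons.
Qed.

Lemma lower_comm r1 r2 w : lower r1 (lower r2 w) = lower r2 (lower r1 w).
Proof. by apply: funext => s; apply: shift_each_comm. Qed.

(** With enough of the tail listed, both sides are sums over ordered pairs
    of entries that get shifted. *)
Lemma raise_comm r1 r2 w : (0 < r1)%N -> (0 < r2)%N -> wedge w ->
  raise r1 (raise r2 w) = raise r2 (raise r1 w).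
Proof.
move=> r10 r20 ww; apply: funext => s.
have raise2 k1 k2 : (0 < k1)%N -> (0 < k2)%N -> raise k1 (raise k2 w) s =
    shift_each k1%:Z (shift_each k2%:Z w) (s ++ tail (size s) (k1 + k2)).
  move=> k10 k20; have -> : tail (size s) (k1 + k2) =
      tail (size s) k1 ++ tail (size s + k1) k2.
    elim: k2 {k20} => [|k2 IHk]; first by rewrite addn0 cats0.
    by rewrite addnS !tailSr IHk rcons_cat addnA.
  rewrite catA [RHS]shift_each_cat [X in _ + X]shift_each_eq0 ?addr0.
    by apply: eq_shift_each => p x q eqt; rewrite /raise;
      have := congr1 size eqt; rewrite !size_cat size_tail /= => ->.
  move=> p x q eqt; set y := x + _.
  have xt : x \in tail (size s + k1) k2 by rewrite eqt mem_cat inE eqxx orbT.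
  apply: alternating_dup; first exact/shift_each_alternating/wedge_alt.
  rewrite catA uniq_middle negb_and negbK; apply/orP; left.
  rewrite -catA !mem_cat -orbA; apply/orP; right.
  have [//|yT1] := boolP (y \in tail (size s) k1).
  have : y \in tail (size s + k1) k2.
    by move: yT1 xt; rewrite !mem_tail /y; lia.
  rewrite eqt mem_cat inE (_ : (y == x) = false) //.
  by apply/negbTE; rewrite /y; lia.
by rewrite !raise2 // shift_each_comm addnC.
Qed.

(** The two orders differ by the terms where a tail entry x is first lowered
    to y. Either y coincides with another listed entry, or it lies below the
    list and has to be raised again; then y + r1 is different from x because
    r1 and r2 are, and it is a repetition or still too low. *)
Lemma raise_lower_comm r1 r2 w : (0 < r1)%N -> (0 < r2)%N -> r1 != r2 -> wedge w ->
  raise r1 (lower r2 w) = lower r2 (raise r1 w).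
Proof.
move=> r10 r20 ner ww; apply: funext => s; have [aw sw] := ww.
rewrite -(raise_extend r2 _ r10 (lower_wedge r20 ww)) shift_each_comm.
rewrite [LHS]shift_each_cat [X in _ + X]shift_each_eq0 ?addr0.
  apply: eq_shift_each => p x q eqs; rewrite -(raise_extend r2 _ r10 ww).
  by rewrite eqs !size_cat.
move=> p x q eqt; set y := x + _.
have xt : x \in tail (size s) (r1 + r2) by rewrite eqt mem_cat inE eqxx orbT.
have mem_pq z : z != x -> z \in tail (size s) (r1 + r2) -> z \in p ++ q.
  by move=> zx; rewrite eqt !mem_cat inE (negPf zx).
have adw := shift_each_alternating r1%:Z aw.
have szpq : size (p ++ q) = (r1 + r2).-1.
  by have := size_tail (size s) (r1 + r2); rewrite eqt !size_cat /= => <-; lia.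
have pyq : perm_eq (s ++ p ++ y :: q) (y :: s ++ p ++ q).
  by rewrite !(catA s); apply/permPl/(perm_catCA (s ++ p) [:: y] q).
apply: (alternating_perm0 adw pyq) => /=.
case: (boolP (y \in s ++ p ++ q)) => [dup|nodup].
  by have := alternating_dup (s := y :: s ++ p ++ q) adw; rewrite /= dup; apply.
rewrite mem_tail in xt.
have ylow : y < - (size s + (r1 + r2))%:Z.
  rewrite ltNge; apply: contra nodup => yge; rewrite mem_cat mem_pq ?orbT //.
    by rewrite /y; lia.
  by rewrite mem_tail yge /= /y; lia.
have szM : size (y :: s ++ p ++ q) = (size s + (r1 + r2))%N.
  by rewrite /= size_cat szpq; lia.
rewrite [X in _ + X]shift_each_eq0 ?addr0 => [|a z b eqspq]; last first.
  apply: (wedge_low ww (x := y)); first by rewrite inE eqxx.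
  by move: szM; rewrite eqspq /= !size_cat /= => ->; exact: ylow.
case: (ltP (y + r1%:Z) (- (size s + (r1 + r2))%:Z)) => [low|ge].
  by apply: (wedge_low ww (x := y + r1%:Z)); [rewrite inE eqxx|rewrite -szM in low].
apply: alternating_dup => //=; rewrite negb_and negbK; apply/orP; left.
rewrite mem_cat mem_pq ?orbT // /y; first lia.
by rewrite mem_tail; apply/andP; split; [exact: ge | rewrite /y; lia].
Qed.

End Operators.

(** * The operators phi on functionals *)

Section Vertex.

Variables (C : numFieldType) (V : lmodType C).
Implicit Types (w : seq int -> V) (s t u v : seq int) (c k : int) (r m : nat).

Lemma set_nth_cat u (x y : int) v : set_nth 0 (u ++ x :: v) (size u) y = u ++ y :: v.
Proof. by elim: u => //= z u ->. Qed.

(** Moving x past v and y, then y back past v, takes an odd number of swaps. *)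
Lemma alternating_swap w u x v y z : alternating w ->
  w (u ++ x :: v ++ y :: z) = - w (u ++ y :: v ++ x :: z).
Proof.
move=> aw.
have mv p a q b : w (p ++ a :: q ++ b) = (-1) ^+ size q *: w (p ++ q ++ a :: b).
  by apply: alternating_at_move (alternatingW aw) _; reflexivity.
by rewrite (mv u x v (y :: z)) (mv u y v (x :: z)) catA aw -catA scalerN.
Qed.

Lemma alternating_set_nth w s p q : alternating w -> (p < q < size s)%N ->
  w (set_nth 0 (set_nth 0 s p s`_q) q s`_p) = - w s.
Proof.
move=> aw /andP[pq qs].
have ps := ltn_trans pq qs.
pose u := take p s; pose v := take (q - p.+1) (drop p.+1 s); pose z := drop q.+1 s.
have szu : size u = p by rewrite size_take ps.
have szv : size v = (q - p.+1)%N.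
  by rewrite size_take size_drop; case: ltnP => //; lia.
have sE : s = u ++ s`_p :: v ++ s`_q :: z.
  rewrite -{1}(cat_take_drop p s) -/u (drop_nth 0 ps) -{1}(cat_take_drop (q - p.+1) (drop p.+1 s)).
  rewrite -/v drop_drop; congr (u ++ _ :: v ++ _).
  by rewrite subnK // (drop_nth 0 qs).
have set1 (x y x' y' : int) : set_nth 0 (set_nth 0 (u ++ x :: v ++ y :: z) p x') q y' =
    u ++ x' :: v ++ y' :: z.
  rewrite -{1}szu set_nth_cat -cat_rcons catA.
  have <- : size (rcons u x' ++ v) = q by rewrite size_cat size_rcons szu szv; lia.
  by rewrite set_nth_cat -catA cat_rcons.
rewrite {1}sE set1 (alternating_swap _ _ _ _ _ aw); congr (- w _).
by rewrite -sE.
Qed.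

(** The list a_(m-1), ..., a_0, in the order used by phi_sequence. *)
Definition phi_prefix m (a : {ffun 'I_m -> int}) : seq int :=
  [seq a (rev_ord i) | i <- enum 'I_m].

Lemma size_phi_prefix m (a : {ffun 'I_m -> int}) : size (phi_prefix a) = m.
Proof. by rewrite size_map size_enum_ord. Qed.

Lemma nth_phi_prefix m (a : {ffun 'I_m -> int}) (i : 'I_m) : (phi_prefix a)`_i = a (rev_ord i).
Proof. by rewrite (nth_map i) ?size_enum_ord // nth_ord_enum. Qed.

Lemma mem_phi_prefix m (a : {ffun 'I_m -> int}) i : a i \in phi_prefix a.
Proof. by apply/mapP; exists (rev_ord i); rewrite ?mem_enum ?rev_ordK. Qed.

Definition add_at m (a : {ffun 'I_m -> int}) i c : {ffun 'I_m -> int} :=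
  [ffun j => a j + c *+ (j == i)].

Lemma shift_each_phi_prefix m (a : {ffun 'I_m -> int}) c w :
  shift_each c w (phi_prefix a) = \sum_(i < m) w (phi_prefix (add_at a i c)).
Proof.
rewrite shift_each_index size_phi_prefix [RHS](reindex_inj rev_ord_inj) /=.
apply: eq_bigr => i _; congr w; apply: (@eq_from_nth _ 0).
  by rewrite size_set_nth !size_phi_prefix; apply/maxn_idPr.
rewrite size_set_nth size_phi_prefix (maxn_idPr (ltn_ord i)) => j ltj.
rewrite nth_set_nth /= -[j]/(val (Ordinal ltj)) !nth_phi_prefix ffunE (inj_eq rev_ord_inj).
rewrite -val_eqE /=; case: eqP => [eqji|_]; last by rewrite mulr0n addr0.
by rewrite mulr1n (_ : Ordinal ltj = i) //; apply: val_inj.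
Qed.

Lemma phi_prefix_tperm m (a : {ffun 'I_m -> int}) i j w : alternating w -> i != j ->
  w (phi_prefix [ffun x => a (tperm i j x)]) = - w (phi_prefix a).
Proof.
move=> aw; wlog ltij : i j / (j < i)%N => [wl|] neij.
  case: (ltngtP i j) => [lt|lt|/val_inj eqij].
  - by rewrite tpermC wl // eq_sym.
  - exact: wl.
  by rewrite eqij eqxx in neij.
have /alternating_set_nth <- // : (rev_ord i < rev_ord j < size (phi_prefix a))%N.
  by rewrite size_phi_prefix ltn_ord andbT /=; have := ltn_ord i; lia.
congr w; apply: (@eq_from_nth _ 0).
  rewrite !size_set_nth !size_phi_prefix; have := ltn_ord (rev_ord i); have := ltn_ord (rev_ord j).
  by lia.
rewrite size_phi_prefix => x ltx.
pose X := Ordinal ltx.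
have nthI (z : 'I_m) : (phi_prefix a)`_(m - z.+1) = a z.
  by rewrite -[(m - z.+1)%N]/(val (rev_ord z)) nth_phi_prefix rev_ordK.
have eqX (z : 'I_m) : (x == m - z.+1)%N = (rev_ord X == z).
  by rewrite -val_eqE /=; have := ltn_ord z; lia.
rewrite nth_set_nth /= nth_set_nth /= !eqX !nthI.
rewrite -[x in RHS]/(val X) -[x in LHS]/(val X) !nth_phi_prefix ffunE.
by case: tpermP => [->|->|/eqP/negPf-> /eqP/negPf->]; rewrite ?eqxx ?(negPf neij).
Qed.

(** Bounding the entries from below bounds them from above, as their sum is
    fixed; so all but finitely many tuples have a low entry. *)
Lemma phi_tuples_bounded m k (N : nat) :
  exists E : seq {ffun 'I_m -> int},
    [/\ uniq E, forall a, a \in E -> phi_tuples m k a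
      & forall a, phi_tuples m k a -> a \notin E -> exists i, a i < - N%:Z].
Proof.
pose S : int := \sum_(i < m) (i : nat)%:Z - k * m%:Z.
pose K := (absz (S + (m * N)%N%:Z)).+1.
pose E0 := [seq [ffun i => (b i : nat)%:Z - N%:Z] | b : {ffun 'I_m -> 'I_K}].
exists (undup [seq a <- E0 | `[<phi_tuples m k a>]]); split; first exact: undup_uniq.
  by move=> a; rewrite mem_undup mem_filter => /andP[/asboolP].
move=> a pa; rewrite mem_undup mem_filter => /nandP[/asboolP //|aE].
have [/existsP[i lti]|/existsPn no] := boolP [exists i, a i < - N%:Z]; first by exists i.
have {}no i : - N%:Z <= a i by rewrite leNgt.
have ub i : (absz (a i + N%:Z)%R < K)%N.
  rewrite ltnS; have sumE : \sum_(j < m) (a j + N%:Z) = S + (m * N)%N%:Z.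
    by rewrite big_split /= pa.2 sumr_const card_ord; congr (_ + _); lia.
  have : a i + N%:Z <= S + (m * N)%N%:Z.
    rewrite -sumE (bigD1 i) //= lerDl sumr_ge0 // => j _; have := no j; lia.
  have := no i; lia.
case/negP: aE; apply/mapP; exists [ffun i => Ordinal (ub i)]; first by rewrite mem_enum.
apply/ffunP => i; rewrite !ffunE /=; have := no i; lia.
Qed.

Lemma size_phi_prefix_cat m (a : {ffun 'I_m -> int}) s :
  size [seq y - m%:Z | y <- phi_prefix a ++ s] = (m + size s)%N.
Proof. by rewrite size_map size_cat size_phi_prefix. Qed.

Lemma wedge_phi_prefix0 m (a : {ffun 'I_m -> int}) i w s : wedge w ->
  a i < - (size s)%:Z -> w [seq y - m%:Z | y <- phi_prefix a ++ s] = 0.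
Proof.
move=> ww lta; apply: (wedge_low ww (x := a i - m%:Z)).
  by apply: map_f; rewrite mem_cat mem_phi_prefix.
rewrite size_phi_prefix_cat; lia.
Qed.

(** Reduces the sums over the infinite set of tuples to sums over one finite
    list, which does not depend on the summand. *)
Lemma fsbig_phi_tuples m k (N : nat) : exists E : seq {ffun 'I_m -> int},
  forall (W : zmodType) (F : {ffun 'I_m -> int} -> W),
    (forall (a : {ffun 'I_m -> int}) i, a i < - N%:Z -> F a = 0) ->
    \sum_(a \in phi_tuples m k) F a = \sum_(a <- E) F a.
Proof.
have [E [uE inE outE]] := phi_tuples_bounded m k N; exists E => W F F0.
rewrite (@fsbigE _ _ _ _ _ E) => [||a /inE //|a pa aE].
- by rewrite big_seq_cond [RHS]big_seq_cond; apply: eq_bigl => a; rewrite andbT;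
    case aE: (a \in E); rewrite //= ?mem_set //; apply: inE.
- exact: uE.
by have [j ltj] := outE a pa aE; apply: F0 ltj.
Qed.

End Vertex.

Section VertexOperator.

Variable C : numFieldType.
Implicit Types (s t u v : seq int) (c k : int) (r m : nat).

(** The transpose of phi_k. *)
Definition vertex (V : lmodType C) m k (w : seq int -> V) s : V :=
  \sum_(a \in phi_tuples m k) w [seq y - m%:Z | y <- phi_prefix a ++ s].

Lemma vertex_sum m k (N : nat) : exists E : seq {ffun 'I_m -> int},
  forall (V : lmodType C) (w : seq int -> V) s, wedge w -> (size s <= N)%N ->
    vertex m k w s = \sum_(a <- E) w [seq y - m%:Z | y <- phi_prefix a ++ s].
Proof.
have [E EP] := fsbig_phi_tuples m k N; exists E => V w s ww szs; apply: EP => a j ltaj.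
by apply: (wedge_phi_prefix0 (i := j) ww); lia.
Qed.

Variable V : lmodType C.
Implicit Types w : seq int -> V.

(** The involution which, up to the shift of the entry i by c, exchanges the
    entries i and j. It respects the residues because j is congruent to i +
    c. *)
Lemma phi_tuples_exchange m (k : int) c (i j : 'I_m) : (j%:Z = i%:Z + c %[mod m])%Z ->
  let sigma a := add_at [ffun x => add_at a i c (tperm i j x)] i (- c) in
  i != j -> set_bij (phi_tuples m k) (phi_tuples m k) sigma.
Proof.
move=> jE sigma neij.
have sigmaE (a : {ffun 'I_m -> int}) : sigma a =
    [ffun x => if x == i then a j - c else if x == j then a i + c else a x].
  apply/ffunP => x; rewrite !ffunE.
  case: tpermP => [->|->|/eqP/negPf xi /eqP/negPf xj].
  - by rewrite eqxx (eq_sym j) (negPf neij) mulr0n addr0 mulr1n.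
  - by rewrite eqxx (eq_sym j) (negPf neij) mulr0n addr0 mulr1n eqxx.
  by rewrite xi xj !mulr0n !addr0.
have sigmaK : involutive sigma.
  move=> a; apply/ffunP => x; rewrite !sigmaE !ffunE eqxx (eq_sym j) (negPf neij).
  by rewrite !eqxx; case: eqP => [->|_]; [rewrite addrK|case: eqP => [->|//]; rewrite subrK].
have sub (a : {ffun 'I_m -> int}) : phi_tuples m k a -> phi_tuples m k (sigma a).
  case=> ra sa; split=> [x|].
    rewrite sigmaE ffunE; case: eqP => [->|_].
      by rewrite -modzDml ra jE modzDml addrK.
    by case: eqP => [->|_ //]; rewrite -modzDml ra jE modzDml.
  have sum_add (b : {ffun 'I_m -> int}) x d : \sum_y add_at b x d y = \sum_y b y + d.
    under eq_bigr do rewrite ffunE; rewrite big_split /=; congr (_ + _).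
    by rewrite (bigD1 x) //= eqxx mulr1n big1 ?addr0 // => y /negPf->.
  rewrite -sa sum_add -[LHS]/(_ - c); apply/eqP; rewrite subr_eq -(sum_add a i c) eq_sym.
  rewrite (reindex_inj (@perm_inj _ (tperm i j))) /=.
  by apply/eqP/eq_bigr => x _; rewrite [RHS]ffunE.
split.
- by move=> a /sub.
- by move=> a b _ _ /(congr1 sigma); rewrite !sigmaK.
by move=> a pa; exists (sigma a); [exact: sub|rewrite sigmaK].
Qed.

(** The tuple with its entry i shifted by c has two entries in one residue
    class, that of i + c, which is not the class of i as m does not divide
    c. The involution exchanging these entries reverses the sign of each
    term. *)
Lemma vertex_antisym m k c (i : 'I_m) w t : (0 < m)%N -> ~~ (m%:Z %| c)%Z -> wedge w ->
  \sum_(a \in phi_tuples m k) w [seq y - m%:Z | y <- phi_prefix (add_at a i c) ++ t] = 0.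
Proof.
move=> m0 ndiv ww; have [aw _] := ww.
pose F (b : {ffun 'I_m -> int}) := w [seq y - m%:Z | y <- phi_prefix b ++ t].
have [E EP] := fsbig_phi_tuples m k (size t + absz c)%N.
have F0 (a : {ffun 'I_m -> int}) x : a x < - (size t + absz c)%N%:Z -> F (add_at a i c) = 0.
  move=> lta; apply: (wedge_phi_prefix0 (i := x) ww); rewrite ffunE.
  by case: (x == i); rewrite ?mulr0n ?mulr1n; lia.
have ltj : (absz ((i%:Z + c) %% m%:Z)%Z < m)%N.
  by have := ltz_pmod (i%:Z + c) (d := m%:Z) m0; have := modz_ge0 (i%:Z + c) (d := m%:Z); lia.
pose j := Ordinal ltj.
have jE : (j%:Z = i%:Z + c %[mod m])%Z.
  rewrite /= gez0_abs ?modz_mod //; apply: modz_ge0; lia.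
have neij : i != j.
  apply: contra ndiv => /eqP eqij; rewrite -eqij in jE.
  by have /eqP := esym jE; rewrite eqz_mod_dvd addrAC subrr add0r.
have eqN : \sum_(a \in phi_tuples m k) F (add_at a i c) =
    - \sum_(a \in phi_tuples m k) F (add_at a i c).
  rewrite {1}(reindex_fsbig _ _ _ _ (phi_tuples_exchange k jE neij)).
  have addK (b : {ffun 'I_m -> int}) : add_at (add_at b i (- c)) i c = b.
    by apply/ffunP => x; rewrite !ffunE -addrA -mulrnDl addNr mul0rn addr0.
  have awt : alternating (fun u => w [seq y - m%:Z | y <- u ++ t]).
    by move=> u x y v; rewrite -!catA !map_cat /= aw.
  rewrite (eq_fsbigr (fun a => - F (add_at a i c))) => [|a _]; last first.
    by rewrite addK /F (phi_prefix_tperm _ awt neij).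
  rewrite (EP _ _ F0) (EP V (fun a : {ffun 'I_m -> int} => - F (add_at a i c))).
    by rewrite sumrN.
  move=> a x /F0 ->.
  by rewrite oppr0.
apply/eqP; have /eqP : 2%:R *: \sum_(a \in phi_tuples m k) F (add_at a i c) = 0.
  by rewrite scaler_nat mulr2n {1}eqN addNr.
by rewrite scaler_eq0 pnatr_eq0.
Qed.

(** The shifts of the prepended entries cancel by vertex_antisym. *)
Lemma vertex_shift_each m k c w t : (0 < m)%N -> ~~ (m%:Z %| c)%Z -> wedge w ->
  \sum_(a \in phi_tuples m k)
     shift_each c w [seq y - m%:Z | y <- phi_prefix a ++ t] =
  shift_each c (vertex m k w) t.
Proof.
move=> m0 ndiv ww; set w' := fun u => w [seq y - m%:Z | y <- u].
pose N := (size t + absz c)%N.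
have [E EP] := fsbig_phi_tuples m k N.
have F0 (a : {ffun 'I_m -> int}) i x : a x < - N%:Z -> w' (phi_prefix (add_at a i c) ++ t) = 0.
  move=> lta; apply: (wedge_phi_prefix0 (i := x) ww); rewrite ffunE.
  by case: (x == i); rewrite ?mulr0n ?mulr1n; rewrite /N in lta; lia.
have splitF (a : {ffun 'I_m -> int}) : shift_each c w [seq y - m%:Z | y <- phi_prefix a ++ t] =
    (\sum_(i < m) w' (phi_prefix (add_at a i c) ++ t)) +
    shift_each c (fun v => w' (phi_prefix a ++ v)) t.
  by rewrite -shift_each_map shift_each_cat (shift_each_phi_prefix a c (fun u => w' (u ++ t))).
have G0 (a : {ffun 'I_m -> int}) x : a x < - N%:Z ->
    shift_each c (fun v => w' (phi_prefix a ++ v)) t = 0.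
  move=> lta; apply: shift_each_eq0 => u y v eqt; apply: (wedge_phi_prefix0 (i := x) ww).
  by rewrite /N eqt !size_cat /= in lta; rewrite size_cat /=; lia.
rewrite EP; last first.
  by move=> a x lta; rewrite splitF (G0 _ _ lta) big1 ?addr0 // => i _; apply: F0 lta.
under eq_bigr do rewrite splitF.
rewrite big_split exchange_big /= big1 ?add0r => [|i _]; last first.
  rewrite -(EP V (fun a : {ffun 'I_m -> int} => w' (phi_prefix (add_at a i c) ++ t))).
    exact: vertex_antisym.
  by move=> a x; apply: F0.
rewrite -shift_each_sum; apply: eq_shift_each => u x v eqt.
rewrite /vertex.
rewrite -(EP V (fun a : {ffun 'I_m -> int} => w' (phi_prefix a ++ u ++ x + c :: v))) //.
move=> a y lta.
by apply: (wedge_phi_prefix0 (i := y) ww); rewrite /N eqt !size_cat /= in lta; rewrite size_cat /=; lia.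
Qed.

Lemma vertex_lower m k r w : (0 < m)%N -> ~~ (m %| r)%N -> wedge w ->
  vertex m k (lower r w) = lower r (vertex m k w).
Proof.
move=> m0 ndiv ww; apply: funext => s; rewrite /lower -vertex_shift_each //.
by rewrite dvdzE abszN.
Qed.

Lemma vertex_raise m k r w : (0 < m)%N -> ~~ (m %| r)%N -> wedge w ->
  vertex m k (raise r w) = raise r (vertex m k w).
Proof.
move=> m0 ndiv ww; apply: funext => s; rewrite /raise -vertex_shift_each //.
apply: eq_fsbigr => a _; congr (shift_each _ _ _).
rewrite size_phi_prefix_cat !map_cat -catA; congr (_ ++ (_ ++ _)).
by rewrite -map_comp; apply: eq_map => j /=; lia.
Qed.

End VertexOperator.

(** * Energy, and the recursion for functionals *)

Section Energy.

Implicit Types (s t : seq int) (l : intpart).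

(** The weight of the partition, extended to all lists: it is additive in
    the entries and does not change when the list is prolonged by its tail. *)
Definition energy s : int := \sum_(x <- s) x + \sum_(i < size s) i.+1%:Z.

Lemma energy_shift u x c v : energy (u ++ (x + c) :: v) = energy (u ++ x :: v) + c.
Proof. by rewrite /energy !big_cat !big_cons /= !size_cat /=; ring. Qed.

Lemma energy_rcons s : energy (rcons s (- (size s).+1%:Z)) = energy s.
Proof.
rewrite /energy -cats1 big_cat big_seq1 size_cat /= addn1 big_ord_recr /=; ring.
Qed.

Lemma energy_tail s r : energy (s ++ tail (size s) r) = energy s.
Proof.
elim: r => [|r IHr]; first by rewrite cats0.
rewrite tailSr -rcons_cat -{2}(size_tail (size s) r) -size_cat.
by rewrite (energy_rcons (s ++ tail (size s) r)).
Qed.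

Lemma energy_perm s t : perm_eq s t -> energy s = energy t.
Proof. by move=> pst; rewrite /energy (perm_big _ pst) (perm_size pst). Qed.

Lemma energy_maya N l : (size l <= N)%N -> energy (maya N l) = (weight l)%:Z.
Proof.
move=> lN; rewrite /energy size_maya /maya big_map -{1}[N]subn0 big_mkord -big_split /=.
under eq_bigr do rewrite addrNK.
rewrite -(big_morph Posz PoszD (erefl _)); congr Posz; rewrite /weight sumnE (big_nth 0%N).
rewrite -(subnKC lN) -(big_mkord xpredT) (big_cat_nat (n := size l)) ?leq_addr //=.
rewrite [X in (_ + X)%N]big_nat_cond [X in (_ + X)%N]big1 ?addn0 //= => i /andP[/andP[li _] _].
by rewrite nth_default.
Qed.

End Energy.

Section Functionals.

Variable C : numFieldType.
Local Notation V := (C^o : lmodType C).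
Implicit Types (w : seq int -> C^o) (s t u v : seq int) (l : intpart) (r m : nat).

Lemma shift_each_linear c : linear (@shift_each V c : (seq int -> V) -> _).
Proof.
move=> a w1 w2; apply: funext => s; rewrite /= !fctE.
elim: s w1 w2 => [|x s IHs] w1 w2 /=; first by rewrite scaler0 addr0.
have -> : (fun t => (a *: w1 + w2) (x :: t)) =
  a *: (fun t => w1 (x :: t)) + (fun t => w2 (x :: t)) by [].
by rewrite IHs scalerDr addrACA.
Qed.

Lemma lower_linear r : linear (@lower C V r).
Proof. exact: shift_each_linear. Qed.

Lemma raise_linear r : linear (@raise C V r).
Proof.
move=> a w1 w2; apply: funext => s; rewrite /raise !fctE.
by rewrite (shift_each_linear _ a w1 w2).
Qed.

(** The transpose of the operator A_r. *)
Definition brauer_dual r w : seq int -> C^o := raise r w + lower r w + eps r *: w.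

Lemma brauer_dual_linear r : linear (brauer_dual r).
Proof.
move=> a w1 w2; rewrite /brauer_dual raise_linear lower_linear !scalerDr.
rewrite [eps r *: (a *: w1)]scalerA [eps r * a]mulrC -scalerA.
by rewrite [X in X + _ = _]addrACA [LHS]addrACA.
Qed.

Lemma wedgeD w1 w2 : wedge w1 -> wedge w2 -> wedge (w1 + w2).
Proof.
move=> [a1 s1] [a2 s2]; split=> [u x y v|s]; rewrite !fctE.
  by rewrite a1 a2 opprD.
by rewrite s1 s2.
Qed.

Lemma wedgeZ a w : wedge w -> wedge (a *: w).
Proof.
move=> [a1 s1]; split=> [u x y v|s]; rewrite !fctE; last by rewrite s1.
by rewrite a1 scalerN.
Qed.

Lemma brauer_dual_wedge r w : (0 < r)%N -> wedge w -> wedge (brauer_dual r w).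
Proof.
move=> r0 ww; apply: wedgeD; last exact: wedgeZ.
by apply: wedgeD; [exact: raise_wedge | exact: lower_wedge].
Qed.

Lemma brauer_dual_comm r1 r2 w : (0 < r1)%N -> (0 < r2)%N -> wedge w ->
  brauer_dual r1 (brauer_dual r2 w) = brauer_dual r2 (brauer_dual r1 w).
Proof.
move=> r10 r20 ww; have [->//|ne12] := eqVneq r1 r2.
rewrite /brauer_dual !(linear_DZ (raise_linear _)) !(linear_DZ (lower_linear _)).
rewrite (raise_comm r10 r20 ww) (lower_comm r1 r2) (raise_lower_comm r10 r20 ne12 ww).
rewrite (raise_lower_comm r20 r10 _ ww); last by rewrite eq_sym.
rewrite !scalerDr !scalerA (mulrC (eps r1)).
set A := raise _ (raise _ _); set B := lower _ (raise _ _); set D := _ *: raise r1 w.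
set E := lower _ (raise _ _); set F := lower _ (lower _ _); set G := _ *: lower r1 w.
set H := _ *: raise r2 w; set I := _ *: lower r2 w; set J := _ *: w.
apply: funext => s; rewrite !fctE; ring.
Qed.

(** Functionals of degree at most d. Raising lowers this bound and lowering
    raises it, since these are transposes. *)
Definition supported_below (d : int) w : Prop := forall s, d < energy s -> w s = 0.

Lemma shift_each_below c d w : supported_below d w ->
  supported_below (d - c) (shift_each c w).
Proof.
move=> dw s lts; apply: shift_each_eq0 => u x v eqs; apply: dw.
by rewrite energy_shift -eqs -ltrBlDr.
Qed.

Lemma raise_below r d w : supported_below d w -> supported_below (d - r%:Z) (raise r w).
Proof.
by move=> dw s lts; apply: (shift_each_below dw); rewrite energy_tail.
Qed.

Lemma brauer_dual_below r d w : supported_below d w ->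
  supported_below (d + r%:Z) (brauer_dual r w).
Proof.
move=> dw s lts; rewrite /brauer_dual !fctE.
have -> : raise r w s = 0 by apply: (raise_below dw); lia.
have -> : lower r w s = 0 by apply: (shift_each_below dw); rewrite opprK.
by rewrite dw ?scaler0 ?addr0 //; lia.
Qed.

Definition empty_intpart : intpart := @IntPart [::] isT.

(** The functional which takes the coefficient of the empty partition; it
    corresponds to the constant term. *)
Definition vacuum s : C^o := coeff empty_intpart (straighten C s).

Lemma vacuum_wedge : wedge vacuum.
Proof.
split=> [u x y v|s]; rewrite /vacuum; first by rewrite straighten_swap coeffN.
by rewrite straighten_rcons.
Qed.

Lemma inversions_sorted s : sorted gt_int s -> inversions s = 0%N.
Proof.
elim: s => [|x s IHs] srt; first by rewrite /inversions big_ord0.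
rewrite inversions_cons IHs ?(path_sorted srt) // addn0; apply/eqP.
rewrite -leqn0 leqNgt -has_count; apply/hasPn => y.
by move/(allP (order_path_min gt_int_trans srt)) => /= yx; rewrite -leNgt ltW.
Qed.

Lemma straighten_ket N l : (size l <= N)%N -> straighten C (maya N l) = ket C l.
Proof.
move=> lN; rewrite (@straighten_maya _ _ l) ?size_maya //.
by rewrite inversions_sorted ?sorted_maya ?scale1r.
Qed.

Lemma coeff_ket l k : coeff l (ket C k) = (k == l)%:R.
Proof. by rewrite coeffU mul1r. Qed.

Lemma vacuum_maya N l : (size l <= N)%N -> vacuum (maya N l) = (l == empty_intpart)%:R.
Proof. by move=> lN; rewrite /vacuum straighten_ket // coeff_ket. Qed.

Lemma maya_empty N : maya N empty_intpart = tail 0 N.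
Proof. by apply: eq_map => i; rewrite nth_nil sub0r add0n. Qed.

Lemma vacuum_neq0 s : vacuum s != 0 -> perm_eq s (tail 0 (size s)).
Proof.
rewrite /vacuum; case: straightenP => [l szl pl|_]; last by rewrite coeff0 eqxx.
rewrite coeffZ coeff_ket; case: (l =P _) => [lE _|_]; first by rewrite -maya_empty -lE.
by rewrite mulr0 eqxx.
Qed.

Lemma vacuum_below : supported_below 0 vacuum.
Proof.
move=> s lts; apply/eqP; apply: contraTT lts => /vacuum_neq0 ps.
by rewrite (energy_perm ps) -maya_empty energy_maya // ltxx.
Qed.

Lemma wedge0 : wedge (0 : seq int -> C^o).
Proof. by split=> // u x y v; apply: (esym (@oppr0 V)). Qed.

(** Multiplication by p_m produces only partitions of positive weight. *)
Lemma raise_vacuum m : (0 < m)%N -> raise m vacuum = 0.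
Proof.
move=> m0; apply: wedge_eq => [||l].
- exact/raise_wedge/vacuum_wedge.
- exact: wedge0.
by apply: (raise_below vacuum_below); rewrite energy_maya //; lia.
Qed.

(** The tuple with entry i at place i, which gives the vacuum when it is
    prepended to the vacuum. *)
Definition residues m : {ffun 'I_m -> int} := [ffun i : 'I_m => (i : nat)%:Z].

(** Prepending m - 1, ..., 0 and shifting by - m maps the vacuum sequence,
    and no other one, to the vacuum sequence. *)
Lemma vacuum_residues m s :
  vacuum [seq y - m%:Z | y <- phi_prefix (residues m) ++ s] = vacuum s.
Proof.
(* Both sides are functionals, so it is enough to compare them at the maya
   diagrams. *)
pose w t := vacuum [seq y - m%:Z | y <- phi_prefix (residues m) ++ t].
have [aw sw] := vacuum_wedge.
have ww : wedge w.
  split=> [u x y v|t]; first by rewrite /w !catA !map_cat /= aw.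
  rewrite /w -rcons_cat map_rcons -[RHS]sw size_phi_prefix_cat.
  by congr (vacuum (rcons _ _)); lia.
have pE : [seq y - m%:Z | y <- phi_prefix (residues m)] = tail 0 m.
  apply: (@eq_from_nth _ 0); first by rewrite size_map size_phi_prefix size_tail.
  rewrite size_map size_phi_prefix => j ltjm.
  rewrite (nth_map 0) ?size_phi_prefix // -[j]/(val (Ordinal ltjm)) nth_phi_prefix ffunE.
  by rewrite nth_mkseq //=; lia.
rewrite -[LHS]/(w s); apply: (congr1 (fun f => f s)); apply: wedge_eq => // l.
rewrite vacuum_maya //; case: eqP => [->|nel]; rewrite /w.
  rewrite /= /maya /= cats0 pE -maya_empty vacuum_maya //.
apply/eqP; apply: contra_notT nel => /vacuum_neq0.
rewrite map_cat pE size_cat size_tail size_map size_maya.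
have -> : tail 0 (m + size l) = tail 0 m ++ [seq y - m%:Z | y <- maya (size l) empty_intpart].
  rewrite -!maya_empty; rewrite -(maya_tail (size l) (isT : (size empty_intpart <= m)%N)).
  congr (_ ++ _); rewrite maya_empty -map_comp; apply: eq_map => i /=; lia.
rewrite perm_cat2l => pl.
have {}pl : perm_eq (maya (size l) l) (maya (size l) empty_intpart).
  by apply: (perm_map_inj (f := fun y : int => y - m%:Z)) pl; apply: addIr.
exact: maya_perm_inj pl.
Qed.

Lemma vacuum_prefix_nonneg m (a : {ffun 'I_m -> int}) i s : m%:Z <= a i ->
  vacuum [seq y - m%:Z | y <- phi_prefix a ++ s] = 0.
Proof.
move=> lea; apply/eqP; apply: contraTT lea => /vacuum_neq0 /perm_mem mem.
have : a i - m%:Z \in [seq y - m%:Z | y <- phi_prefix a ++ s].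
  by apply: map_f; rewrite mem_cat mem_phi_prefix.
rewrite mem mem_tail; lia.
Qed.

(** Only tuples with entries below m can occur in the vacuum; each entry a_i
    is then i minus a nonnegative multiple of m, and the total of the
    multiples is k. *)
Lemma phi_tuples_small m k (a : {ffun 'I_m -> int}) : phi_tuples m k a ->
    (forall i, a i < m%:Z) ->
  exists c : 'I_m -> nat, (forall i, a i = i%:Z - (c i * m)%N%:Z)
    /\ ((0 < m)%N -> (\sum_i c i)%N%:Z = k).
Proof.
case=> ra sa lta.
have cP i : exists c : nat, a i = i%:Z - (c * m)%N%:Z.
  have := ra i; rewrite [RHS]modz_small; last by rewrite lez_nat ltz_nat ltn_ord.
  move=> ri; have aE := divz_eq (a i) m%:Z; rewrite ri in aE.
  have q0 : (a i %/ m)%Z <= 0.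
    rewrite leNgt; apply/negP => q0; have := lta i; rewrite aE.
    have : (m%:Z <= (a i %/ m)%Z * m%:Z) by rewrite ler_peMl //; lia.
    lia.
  exists (absz (a i %/ m)%Z); rewrite {1}aE PoszM lez0_abs //; ring.
have [c cE] := choice cP; exists c; split=> // m0.
apply/(mulIf (x := m%:Z)); first by rewrite eqz_nat -lt0n.
have -> : k * m%:Z = \sum_(i < m) (i : nat)%:Z - \sum_i a i.
  by rewrite sa opprB addrC subrK.
rewrite -sumrB (big_morph Posz PoszD (erefl _)) mulr_suml.
by apply: eq_bigr => i _; rewrite cE PoszM; ring.
Qed.

(** All the multiples of phi_tuples_small vanish, so only the tuple of
    residues contributes. *)
Lemma vertex_vacuum0 m : (0 < m)%N -> vertex m 0 vacuum = vacuum.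
Proof.
move=> m0; apply: funext => s; rewrite /vertex (fsbigE [:: residues m]) //.
- rewrite big_mkcond big_seq1 mem_set ?vacuum_residues //=.
  by split=> [i|]; rewrite ?ffunE // mul0r subr0; apply: eq_bigr => i _; rewrite ffunE.
- move=> a; rewrite /= inE => /eqP ->.
  by split=> [i|]; rewrite ?ffunE // mul0r subr0; apply: eq_bigr => i _; rewrite ffunE.
move=> a pa; rewrite inE => nea.
have [/existsP[j lej]|/existsPn small] := boolP [exists j, m%:Z <= a j].
  exact: vacuum_prefix_nonneg lej.
have {}small j : a j < m%:Z by rewrite ltNge.
have [c [cE /(_ m0) sumc]] := phi_tuples_small pa small.
case/eqP: nea; apply/ffunP => j; rewrite ffunE cE.
have /eqP : (\sum_j c j = 0)%N by case: sumc.
by rewrite sum_nat_eq0 => /forallP/(_ j)/eqP ->; rewrite mul0n subr0.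
Qed.

(** One of the multiples of phi_tuples_small is 1 and the others vanish, so
    the contributing tuples are the residues with one entry lowered by m. *)
Lemma vertex_vacuum1_sum m s : (0 < m)%N ->
  vertex m 1 vacuum s =
  \sum_(i < m) vacuum [seq y - m%:Z | y <- phi_prefix (add_at (residues m) i (- m%:Z)) ++ s].
Proof.
move=> m0; pose e i := add_at (residues m) i (- m%:Z).
have inj_e : injective e.
  move=> i j /ffunP/(_ i); rewrite !ffunE eqxx mulr1n; case: (i =P j) => // _.
  by rewrite mulr0n addr0; lia.
have pe i : phi_tuples m 1 (e i).
  split=> [j|].
    rewrite !ffunE; case: eqP => [->|_]; last by rewrite mulr0n addr0.
    by apply/eqP; rewrite mulr1n eqz_mod_dvd addrAC subrr add0r dvdzE abszN.
  under eq_bigr do rewrite !ffunE.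
  rewrite big_split /= mul1r; congr (_ + _).
  by rewrite (bigD1 i) //= eqxx mulr1n big1 ?addr0 // => j /negPf ->.
rewrite /vertex (fsbigE [seq e i | i <- enum 'I_m]).
- rewrite big_map -big_filter big_filter big_enum_cond /=.
  by apply: eq_bigl => i; rewrite mem_set.
- by rewrite map_inj_uniq ?enum_uniq.
- by move=> a /= /mapP[i _ ->].
move=> a pa nea.
have [/existsP[j lej]|/existsPn small] := boolP [exists j, m%:Z <= a j].
  exact: vacuum_prefix_nonneg lej.
have {}small j : a j < m%:Z by rewrite ltNge.
have [c [cE /(_ m0) [sumc]]] := phi_tuples_small pa small.
have [i ci] : exists i, (0 < c i)%N.
  apply/existsP; rewrite -[X in is_true X]negbK negb_exists; apply/negP => /forallP c0.
  by move: sumc; rewrite big1 // => j _; apply/eqP; rewrite -leqn0 leqNgt.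
move: sumc; rewrite (bigD1 i) //= => sumc.
have ci1 : c i = 1%N.
  by apply/eqP; rewrite eqn_leq ci andbT -sumc leq_addr.
move/eqP: sumc; rewrite ci1 -[X in _ == X]addn0 eqn_add2l.
rewrite sum_nat_eq0 => /forall_inP cj0.
case/negP: nea; apply/mapP; exists i; first by rewrite mem_enum.
apply/ffunP => j; rewrite !ffunE cE; case: eqP => [->|/eqP nej].
  by rewrite ci1 mulr1n mul1n.
by rewrite (eqP (cj0 j nej)) mulr0n.
Qed.

(** The list contains - m, ..., - 1. An entry which can be lowered by m to
    yield the vacuum must be nonnegative, hence at most m - 1, and lands on
    one of these. *)
Lemma lower_vacuum_residues m s : (0 < m)%N ->
  lower m vacuum [seq y - m%:Z | y <- phi_prefix (residues m) ++ s] = 0.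
Proof.
move=> m0; set t : seq int := map _ _; have [aw sw] := vacuum_wedge.
have [ut|/alternating_dup -> //] := boolP (uniq t); last exact: shift_each_alternating.
have memt (x : int) : - m%:Z <= x -> x < 0 -> x \in t.
  move=> gex ltx; have lt : (absz (x + m%:Z)%R < m)%N by lia.
  apply/mapP; exists (residues m (Ordinal lt)); first by rewrite mem_cat mem_phi_prefix.
  by rewrite ffunE /=; lia.
apply: shift_each_eq0 => u y v eqt; rewrite eqt uniq_middle in ut.
have /andP[ynuv uuv] := ut.
apply/eqP; apply: contraT => /vacuum_neq0 pv.
have := perm_uniq pv; rewrite -maya_empty uniq_maya uniq_middle => /andP[yuv _].
pose M : nat := size (u ++ y - m%:Z :: v).
have mem (x : int) : (x \in u ++ y - m%:Z :: v) = (- M%:Z <= x) && (x < 0).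
  by rewrite (perm_mem pv) mem_tail add0n oppr0.
have ym : (- M%:Z <= y - m%:Z) && (y - m%:Z < 0).
  by rewrite -mem mem_cat inE eqxx orbT.
(* If y were negative, it would have to occur in the vacuum sequence. *)
have yge : 0 <= y.
  have : y \notin u ++ y - m%:Z :: v.
    move: ynuv; rewrite !mem_cat inE !negb_or => /andP[-> ->].
    by rewrite andbT /=; lia.
  by rewrite mem; lia.
have := memt (y - m%:Z); rewrite eqt mem_cat inE.
have -> : (y - m%:Z == y) = false by lia.
by rewrite /= -mem_cat (negPf yuv) => /(_ _ _)/implyP; lia.
Qed.

(** The sum over all the ways of lowering one entry of residues ++ x
    vanishes. The entries of the residues contribute the left-hand side, and
    the entries of x the lowering of the vacuum. *)
Lemma vertex_vacuum1 m : (0 < m)%N -> vertex m 1 vacuum = - lower m vacuum.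
Proof.
move=> m0; apply/eqP; rewrite -addr_eq0; apply/eqP/funext => s; rewrite !fctE.
rewrite vertex_vacuum1_sum //.
rewrite -(shift_each_phi_prefix _ _ (fun t => vacuum [seq y - m%:Z | y <- t ++ s])).
have -> : lower m vacuum s = shift_each (- m%:Z)
    (fun t => vacuum [seq y - m%:Z | y <- phi_prefix (residues m) ++ t]) s.
  by apply: eq_shift_each => u x v _; rewrite vacuum_residues.
rewrite -(shift_each_cat _ (fun t => vacuum [seq y - m%:Z | y <- t])).
by rewrite shift_each_map; apply: lower_vacuum_residues.
Qed.

(** The transposes are applied in the order of the list, so the first part
    belongs to the outermost of the operators A_r. *)
Definition brauer_functional w (mu : seq nat) : seq int -> C^o :=
  foldl (fun w r => brauer_dual r w) w mu.

Lemma brauer_functional_wedge w mu : wedge w -> all (leq 1) mu ->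
  wedge (brauer_functional w mu).
Proof.
elim: mu w => //= r mu IHmu w ww /andP[r0 mu0]; apply: IHmu => //.
exact: brauer_dual_wedge.
Qed.

Lemma brauer_functional_linear mu : linear (brauer_functional^~ mu).
Proof.
elim: mu => [|r mu IHmu] a w1 w2 //=.
by rewrite brauer_dual_linear; apply: IHmu.
Qed.

(** Transport of an operator through the whole product, given that it
    commutes with each factor. *)
Lemma brauer_functional_comm (X : (seq int -> C^o) -> (seq int -> C^o)) mu w :
    all (leq 1) mu -> wedge w ->
    (forall r w, r \in mu -> wedge w -> X (brauer_dual r w) = brauer_dual r (X w)) ->
  X (brauer_functional w mu) = brauer_functional (X w) mu.
Proof.
elim: mu w => //= r mu IHmu w /andP[r0 mu0] ww comX.
rewrite IHmu //; last by move=> q v qmu; apply: comX; rewrite inE qmu orbT.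
  by rewrite comX // inE eqxx.
exact: brauer_dual_wedge.
Qed.

Lemma brauer_functional_cons r mu w : (0 < r)%N -> all (leq 1) mu -> wedge w ->
  brauer_dual r (brauer_functional w mu) = brauer_functional w (r :: mu).
Proof.
move=> r0 mu0 ww; apply: brauer_functional_comm => // q v qmu vw.
by apply: brauer_dual_comm => //; apply: (allP mu0).
Qed.

(** The factors commute, so only the multiset of the parts matters. *)
Lemma brauer_functional_perm mu nu w : wedge w -> all (leq 1) mu -> perm_eq mu nu ->
  brauer_functional w mu = brauer_functional w nu.
Proof.
move=> + + pmn; elim: mu nu pmn w => [|r mu IHmu] nu.
  by rewrite perm_sym => /perm_nilP ->.
move=> pmn w ww /= /andP[r0 mu0].
have rnu : r \in nu by rewrite -(perm_mem pmn) inE eqxx.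
have [nu1 [nu2 nuE]] : exists nu1 nu2, nu = nu1 ++ r :: nu2.
  by case/splitPr: rnu => nu1 nu2; exists nu1, nu2.
have pmu : perm_eq mu (nu1 ++ nu2).
  rewrite -(perm_cons r) (perm_trans pmn) // nuE.
  exact/permPl/(perm_catCA nu1 [:: r] nu2).
have nu10 : all (leq 1) nu1 by move: mu0; rewrite (perm_all _ pmu) all_cat => /andP[].
have -> := IHmu _ pmu _ (brauer_dual_wedge r0 ww) mu0.
rewrite nuE /brauer_functional !foldl_cat /=; congr foldl.
by rewrite -/(brauer_functional w nu1) brauer_functional_cons.
Qed.

Lemma brauer_functional_below mu d w : supported_below d w ->
  supported_below (d + (sumn mu)%:Z) (brauer_functional w mu).
Proof.
elim: mu d w => [|r mu IHmu] d w dw /=; first by rewrite addr0.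
by rewrite PoszD addrA; apply/IHmu/brauer_dual_below.
Qed.

Lemma vertex_linear m k a w1 w2 : wedge w1 -> wedge w2 ->
  vertex m k (a *: w1 + w2) = a *: vertex m k w1 + vertex m k w2.
Proof.
move=> ww1 ww2; apply: funext => s; rewrite !fctE.
have [E EP] := @vertex_sum C m k (size s).
have ww : wedge (a *: w1 + w2) by apply: wedgeD => //; apply: wedgeZ.
rewrite (EP _ _ _ ww) // (EP _ _ _ ww1) // (EP _ _ _ ww2) // scaler_sumr -big_split.
by apply: eq_bigr => b _; rewrite !fctE.
Qed.

Lemma vertex_brauer_dual m k r w : (0 < m)%N -> (0 < r)%N -> ~~ (m %| r)%N -> wedge w ->
  vertex m k (brauer_dual r w) = brauer_dual r (vertex m k w).
Proof.
move=> m0 r0 ndiv ww; rewrite /brauer_dual.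
have rw := raise_wedge r0 ww; have lw := lower_wedge r0 ww.
rewrite addrC vertex_linear //; last exact: wedgeD.
rewrite -[raise r w]scale1r vertex_linear // !scale1r vertex_raise // vertex_lower //.
by rewrite addrC.
Qed.

(** With A_m moved next to the vacuum, its p_m kills the vacuum and its
    p_m^perp acts as - phi_1; the operators phi then commute with the
    remaining factors. *)
Lemma brauer_functional_recursion m (mu nu : seq nat) :
    (0 < m)%N -> all (leq 1) mu -> all (fun r => ~~ (m %| r)%N) mu ->
    perm_eq nu (rcons mu m) ->
  let w := brauer_functional vacuum mu in
  brauer_functional vacuum nu = eps m *: w - vertex m 1 w /\ w = vertex m 0 w.
Proof.
move=> m0 mu0 ndiv pnu w.
have vw := vacuum_wedge.
have vcomm k : vertex m k w = brauer_functional (vertex m k vacuum) mu.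
  apply: brauer_functional_comm => // r v rmu wv.
  by apply: vertex_brauer_dual => //; [apply: (allP mu0)|apply: (allP ndiv)].
split; last by rewrite vcomm vertex_vacuum0.
have -> : brauer_functional vacuum nu = brauer_functional vacuum (m :: mu).
  apply: brauer_functional_perm => //.
    by rewrite (perm_all _ pnu) all_rcons m0.
  by rewrite (perm_trans pnu) // perm_rcons.
rewrite vcomm vertex_vacuum1 //= /brauer_dual raise_vacuum // add0r addrC.
rewrite brauer_functional_linear; congr (_ + _).
have -> : - lower m vacuum = (-1) *: lower m vacuum by rewrite scaleN1r.
by rewrite (linear_DZ (brauer_functional_linear mu)).2 scaleN1r opprK.
Qed.

End Functionals.

(** * Determinants and adjointness of raising and lowering *)

Section Determinants.

Variable R : comNzRingType.

(** A with its column j replaced by b. *)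
Definition set_col N (A : 'M[R]_N) j (b : 'I_N -> R) : 'M[R]_N :=
  \matrix_(i, k) if k == j then b i else A i k.

Lemma det_set_col N (A : 'M[R]_N) j (b : 'I_N -> R) :
  \det (set_col A j b) = \sum_i b i * cofactor A i j.
Proof.
rewrite (expand_det_col _ j); apply: eq_bigr => i _; rewrite mxE eqxx.
congr (_ * ((-1) ^+ _ * \det (row' _ _))); apply/matrixP => x y.
by rewrite !mxE eq_sym (negPf (neq_lift _ _)).
Qed.

(** Both sides are the derivative at t = 0 of the determinant of the matrix
    with entries (1 + t a_i) A_ij. In terms of cofactors, it is an exchange
    of summations. *)
Lemma sum_det_set_col_scale N (A : 'M[R]_N) (a : 'I_N -> R) :
  \sum_j \det (set_col A j (fun i => a i * A i j)) = (\sum_i a i) * \det A.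
Proof.
under eq_bigr do rewrite det_set_col.
rewrite exchange_big mulr_suml /=; apply: eq_bigr => i _.
rewrite (expand_det_row A i) mulr_sumr; apply: eq_bigr => j _.
exact: (esym (mulrA _ _ _)).
Qed.

(** Replacing in turn each column, or each row, by those of another matrix
    gives the same sum: the derivative of the determinant in the direction
    of this matrix. *)
Lemma sum_det_set_col_tr N (A : 'M[R]_N) (b : 'I_N -> 'I_N -> R) :
  \sum_j \det (set_col A j (b^~ j)) = \sum_j \det (set_col A^T j (b j)).
Proof.
under eq_bigr do rewrite det_set_col.
under [RHS]eq_bigr do rewrite det_set_col.
rewrite exchange_big /=; apply: eq_bigr => i _; apply: eq_bigr => j _.
by rewrite cofactor_tr.
Qed.

End Determinants.

Section DetFunctional.

Variables (C : numFieldType) (R : comAlgType C).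
Implicit Types (s u v : seq int).

Definition det_functional N (g : 'I_N -> int -> R) s : R :=
  \det (\matrix_(i < N, j < N) g i s`_j).

(** Swapping neighbours in a list, seen as a transposition of the positions. *)
Lemma nth_swap N u (x y : int) v (j1 j2 j : 'I_N) : j1 = size u :> nat -> j2 = (size u).+1 :> nat ->
  (u ++ y :: x :: v)`_(tperm j1 j2 j) = (u ++ x :: y :: v)`_j.
Proof.
move=> j1E j2E; rewrite !nth_cat.
case: tpermP => [->|->|/eqP nj1 /eqP nj2]; rewrite ?j1E ?j2E.
- by rewrite ltnn subnn (ltnNge _ (size u)) leqnSn /= subSn // subnn.
- by rewrite ltnn subnn (ltnNge _ (size u)) leqnSn /= subSn // subnn.
case: ltnP => // leuj; move: nj1 nj2; rewrite -!val_eqE /= j1E j2E => nj1 nj2.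
rewrite leq_eqVlt eq_sym (negPf nj1) /= leq_eqVlt eq_sym (negPf nj2) /= in leuj.
by rewrite -(subnK leuj) -addSnnS -addSnnS addnK.
Qed.

Lemma det_functional_alternating N (g : 'I_N -> int -> R) :
  alternating_at N (det_functional g : seq int -> R).
Proof.
move=> u x y v szN.
have lt1 : (size u < N)%N by rewrite -szN size_cat /=; lia.
have lt2 : ((size u).+1 < N)%N by rewrite -szN size_cat /=; lia.
pose j1 := Ordinal lt1; pose j2 := Ordinal lt2.
rewrite /det_functional; set A := \matrix_(i, j) _; set B := \matrix_(i, j) _.
have -> : A = col_perm (tperm j1 j2) B.
  by apply/matrixP => i j; rewrite !mxE (@nth_swap N u x y v j1 j2).
rewrite col_permE det_mulmx det_perm odd_permV odd_tperm.
have -> : (j1 != j2) by rewrite -val_eqE /= neq_ltn ltnSn.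
by rewrite /= expr1 mulrN1.
Qed.

Lemma det_functional_clipped N (g : 'I_N -> int -> R) :
  (forall i x, x < - N%:Z -> g i x = 0) -> clipped_at N (det_functional g).
Proof.
move=> g0 s szN /(has_nthP 0) [j ltj ltsj]; rewrite szN in ltj.
rewrite /det_functional (expand_det_col _ (Ordinal ltj)) big1 // => i _.
by rewrite mxE g0 ?mul0r.
Qed.

Lemma shift_each_det N (g : 'I_N -> int -> R) c s : size s = N ->
  shift_each c (det_functional g) s =
  \sum_(j < N) \det (set_col (\matrix_(i < N, j < N) g i s`_j) j (fun i => g i (s`_j + c))).
Proof.
move=> szN; rewrite shift_each_index szN; apply: eq_bigr => j _.
rewrite /det_functional; congr (\det _); apply/matrixP => i k; rewrite !mxE nth_set_nth /=.
by rewrite -val_eqE /=; case: (_ == _).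
Qed.

End DetFunctional.

Section CoefficientDeterminant.

Variable C : numFieldType.
Implicit Types (s : seq int) (l k : intpart).

Definition kronecker M k : 'I_M -> int -> C^o := fun i x => (x == (maya M k)`_i)%:R.

(** If the strictly decreasing lists differ, an entry of f is missing in e
    and gives a zero row. *)
Lemma sorted_kronecker N (e f : seq int) : size e = N -> size f = N ->
    sorted gt_int e -> sorted gt_int f ->
  \det (\matrix_(i < N, j < N) (e`_j == f`_i)%:R : 'M[C]_N) = (e == f)%:R.
Proof.
move=> sze szf se sf; have [<-|nef] := eqVneq e f.
  rewrite (_ : \matrix_(i, j) _ = 1%:M) ?det1 //; apply/matrixP => i j; rewrite !mxE.
  by rewrite nth_uniq ?sze ?(sorted_uniq gt_int_trans gt_int_irr) // eq_sym.
have [x xe xf] : exists2 x, x \in f & x \notin e.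
  apply/hasP; rewrite -[has _ _]negbK -all_predC; apply: contra nef => /allP sub.
  apply/eqP/(irr_sorted_eq gt_int_trans gt_int_irr se sf).
  have ue := sorted_uniq gt_int_trans gt_int_irr se.
  have uf := sorted_uniq gt_int_trans gt_int_irr sf.
  have fe : {subset f <= e} by move=> y /sub /=; rewrite negbK.
  have lesz : (size e <= size f)%N by rewrite sze szf.
  by have [_ eqm] := uniq_min_size uf fe lesz; move=> y; rewrite eqm.
have lti : (index x f < N)%N by rewrite -szf index_mem.
rewrite (expand_det_row _ (Ordinal lti)) big1 // => j _; rewrite mxE /= nth_index //.
rewrite (_ : (_ == x) = false) ?mul0r //; apply: contraNF xf => /eqP <-.
by rewrite mem_nth // sze.
Qed.

(** The universal property applied to a determinant that detects the maya
    diagram of k. *)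
Lemma coeff_straighten M k s : size s = M -> (size k <= M)%N ->
  coeff k (straighten C s) = det_functional (@kronecker M k) s.
Proof.
move=> szM kM; rewrite -[LHS]/(fglift (fun l => (l == k)%:R : C^o) (straighten C s)).
apply: (@straighten_lift_at C C^o M (det_functional (@kronecker M k)) _ s) => [|||l lM] //.
- exact: det_functional_alternating.
- apply: det_functional_clipped => i x ltx; rewrite /kronecker.
  case: eqP => // xE; have : (maya M k)`_i \in maya M k by rewrite mem_nth ?size_maya.
  by move/maya_ge; rewrite -xE; lia.
rewrite /det_functional /kronecker.
rewrite (@sorted_kronecker _ (maya M l) (maya M k)) ?size_maya ?sorted_maya //.
case: (l =P k) => [->|nlk]; first by rewrite eqxx.
by case: eqP => // /(maya_inj lM kM).
Qed.

(** Shifting the column index by c is the same as shifting the row index by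
    - c; the sum over the columns turns into the sum over the rows by
    sum_det_set_col_tr. *)
Lemma coeff_shift_adjoint M c k l : (size k <= M)%N -> (size l <= M)%N ->
  coeff l (shift_each c (straighten C) (maya M k)) =
  coeff k (shift_each (- c) (straighten C) (maya M l)).
Proof.
move=> kM lM.
have coeff_shift d (p q : intpart) : (size p <= M)%N -> (size q <= M)%N ->
    coeff p (shift_each d (straighten C) (maya M q)) =
    \sum_(j < M) \det (set_col (\matrix_(i < M, j < M) kronecker p i (maya M q)`_j) j
                        (fun i => kronecker p i ((maya M q)`_j + d))).
  move=> pM qM; rewrite -shift_each_det ?size_maya // !shift_each_index size_maya raddf_sum.
  apply: eq_bigr => j _; rewrite /= (@coeff_straighten M) //.
  by rewrite size_set_nth size_maya (maxn_idPr (ltn_ord j)).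
rewrite !coeff_shift // (sum_det_set_col_tr _ (fun i j => kronecker l i ((maya M k)`_j + c))).
apply: eq_bigr => j _; congr (\det _); apply/matrixP => i x; rewrite !mxE /kronecker.
case: ifP => _; first by rewrite subr_eq eq_sym.
by rewrite eq_sym.
Qed.

End CoefficientDeterminant.

(** * Alternants *)

Section Alternants.

Variable C : numFieldType.
Implicit Types (s : seq int) (l k : intpart) (N : nat).

(** The alternant of a list of exponents x + N, extended by 0 to negative
    exponents, so that it vanishes on clipped lists. *)
Definition bialternant N : seq int -> {mpoly C[N]} :=
  det_functional (fun (i : 'I_N) (x : int) =>
    if - N%:Z <= x then 'X_i ^+ absz (x + N%:Z) else 0).

Lemma bialternant_alternating N : alternating_at N (@bialternant N).
Proof. exact: det_functional_alternating. Qed.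

Lemma bialternant_clipped N : clipped_at N (@bialternant N).
Proof. by apply: det_functional_clipped => i x ltx; rewrite leNgt ltx. Qed.

Lemma bialternant_maya N l : bialternant N (maya N l) = alternant C N l.
Proof.
congr (\det _); apply/matrixP => i j; rewrite !mxE nth_maya //.
have ltj := ltn_ord j; case: ifP; last by lia.
by move=> _; congr ('X_i ^+ _); rewrite /=; lia.
Qed.

(** The exponent of the leading monomial of the alternant. *)
Definition staircase N (a : seq nat) : 'X_{1..N} :=
  [multinom (nth 0%N a i + rev_ord i)%N | i < N].

Lemma mcoeff_alternant N (a : seq nat) (k : 'X_{1..N}) :
  (alternant C N a)@_k =
  \det (\matrix_(i < N, j < N) (staircase N a j == k i)%:R : 'M[C]_N).
Proof.
rewrite /alternant /determinant raddf_sum /=; apply: eq_bigr => p _.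
rewrite mulr_sign [RHS]mulr_sign.
have -> : \prod_(i < N) (\matrix_(i < N, j < N)
      ('X_i ^+ (nth 0%N a j + rev_ord j) : {mpoly C[N]})) i (p i)
    = 'X_[[multinom staircase N a (p i) | i < N]].
  rewrite (mpolyXE _ 1%g); apply: eq_bigr => i _.
  by rewrite mxE perm1 !mnmE.
have -> : \prod_(i < N) (\matrix_(i < N, j < N) (staircase N a j == k i)%:R : 'M[C]_N) i (p i)
   = ('X_[[multinom staircase N a (p i) | i < N]])@_k.
  rewrite mcoeffX; case: eqP => [<-|nek].
    by rewrite big1 // => i _; rewrite !mxE !mnmE eqxx.
  apply/eqP; rewrite prodf_seq_eq0; apply/hasP.
  have [/forallP eqk|/forallPn[j nej]] := boolP [forall j, staircase N a (p j) == k j].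
    by case: nek; apply/mnmP => j; rewrite mnmE; apply/eqP.
  by exists j; rewrite ?mem_index_enum //= mxE (negPf nej).
by case: (odd_perm p); rewrite ?mcoeffN.
Qed.

Lemma staircase_maya N l (i : 'I_N) : (staircase N l i)%:Z = (maya N l)`_i + N%:Z.
Proof. by rewrite mnmE nth_maya //=; have := ltn_ord i; lia. Qed.

Lemma mcoeff_alternant_staircase N l k : (size l <= N)%N -> (size k <= N)%N ->
  (alternant C N l)@_(staircase N k) = (l == k)%:R.
Proof.
move=> lN kN; rewrite mcoeff_alternant.
have -> : \matrix_(i, j) (staircase N l j == staircase N k i)%:R =
   \matrix_(i < N, j < N) ((maya N l)`_j == (maya N k)`_i)%:R :> 'M[C]_N.
  apply/matrixP => i j; rewrite !mxE -eqz_nat !staircase_maya.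
  by rewrite (inj_eq (addIr _)).
rewrite sorted_kronecker ?size_maya ?sorted_maya //.
case: (l =P k) => [->|nlk]; first by rewrite eqxx.
by case: eqP => // /(maya_inj lN kN).
Qed.

Lemma mdeg_staircase N l : (size l <= N)%N ->
  mdeg (staircase N l) = (weight l + mdeg (staircase N [::]))%N.
Proof.
move=> lN; apply/eqP; rewrite -eqz_nat PoszD -(energy_maya lN) !mdegE.
rewrite /energy size_maya !(big_morph Posz PoszD (erefl _)) /maya big_map.
rewrite (_ : iota 0 N = index_iota 0 N) ?big_mkord; last by rewrite /index_iota subn0.
rewrite -!big_split /=; apply/eqP/eq_bigr => i _.
by rewrite !mnmE nth_nil; lia.
Qed.

Lemma mdeg_supp_alternant N l (k : 'X_{1..N}) : (size l <= N)%N ->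
  k \in msupp (alternant C N l) -> mdeg k = mdeg (staircase N l).
Proof.
move=> lN; rewrite mcoeff_msupp mcoeff_alternant /determinant => nz.
have [p prod_nz] : exists p : 'S_N,
    \prod_(i < N) (\matrix_(i < N, j < N) (staircase N l j == k i)%:R : 'M[C]_N) i (p i) != 0.
  apply/existsP; apply: contraNT nz => /existsPn nz.
  by rewrite big1 // => p _; have := nz p; rewrite negbK => /eqP ->; rewrite mulr0.
rewrite !mdegE [RHS](reindex_inj (@perm_inj _ p)) /=; apply: eq_bigr => i _.
move: prod_nz; rewrite (bigD1 i) //= mulf_eq0 negb_or mxE => /andP[+ _].
by case: (staircase N l (p i) =P k i) => //; rewrite eqxx.
Qed.

Lemma alternant_neq0 N l : (size l <= N)%N -> alternant C N l != 0.
Proof.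
move=> lN; apply/eqP => /(congr1 (mcoeff (staircase N l))).
by rewrite mcoeff_alternant_staircase // eqxx mcoeff0 => /eqP; rewrite oner_eq0.
Qed.

Lemma msize_alternant N l : (size l <= N)%N ->
  msize (alternant C N l) = (mdeg (staircase N l)).+1.
Proof.
move=> lN; apply/eqP; rewrite eqn_leq; apply/andP; split.
  rewrite msizeE; apply/bigmax_leqP_seq => k /(mdeg_supp_alternant lN) -> _.
  exact: leqnn.
apply: msize_mdeg_lt; rewrite mcoeff_msupp mcoeff_alternant_staircase // eqxx.
exact: oner_neq0.
Qed.

(** Multiplying row i by X_i ^ r for each i in turn is the same as raising
    the exponents of the columns in turn. *)
Lemma power_sum_bialternant N r s : size s = N -> all (fun x => - N%:Z <= x) s ->
  (\sum_(i < N) 'X_i ^+ r) * bialternant N s = shift_each r%:Z (@bialternant N) s.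
Proof.
move=> szN ges; rewrite /bialternant shift_each_det // -sum_det_set_col_scale.
apply: eq_bigr => j _; congr (\det _); apply/matrixP => i x; rewrite !mxE.
case: ifP => // _.
have gesj : - N%:Z <= s`_j by apply: (allP ges); rewrite mem_nth // szN.
rewrite gesj -exprD; case: ifP; last by lia.
by move=> _; congr ('X_i ^+ _); lia.
Qed.

(** As a function of its exponents, an antisymmetric polynomial is an
    alternating function, determined by its values at the maya diagrams. *)
Lemma alternating_poly_eq0 N (p : {mpoly C[N]}) :
    (forall (k : 'X_{1..N}) (i j : 'I_N), i != j ->
       p@_[multinom k (tperm i j x) | x < N] = - p@_k) ->
    (forall l, (size l <= N)%N -> p@_(staircase N l) = 0) ->
  p = 0.
Proof.
move=> anti p0.
pose w (s : seq int) : C^o := if all (fun x => - N%:Z <= x) s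
  then p@_[multinom absz (s`_i + N%:Z)%R | i < N] else 0.
have aw : alternating_at N w.
  move=> u x y v szN; rewrite /w.
  have -> : all (fun x => - N%:Z <= x) (u ++ y :: x :: v) =
            all (fun x => - N%:Z <= x) (u ++ x :: y :: v).
    by rewrite !all_cat /=; congr (_ && _); rewrite andbCA.
  case: ifP => _; last by rewrite oppr0.
  have lt1 : (size u < N)%N by rewrite -szN size_cat /=; lia.
  have lt2 : ((size u).+1 < N)%N by rewrite -szN size_cat /=; lia.
  rewrite -(anti _ (Ordinal lt1) (Ordinal lt2)); last by rewrite -val_eqE /= neq_ltn ltnSn.
  congr (p@__); apply/mnmP => i; rewrite !mnmE.
  by rewrite -(@nth_swap N u x y v (Ordinal lt1) (Ordinal lt2)).
have cw : clipped_at N w.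
  move=> s szN; rewrite /w; case: ifP => // /allP ge /hasP[x /ge]; rewrite leNgt.
  by move=> /negbTE ->.
apply/mpolyP => k; rewrite mcoeff0.
pose s := mkseq (fun i => (if insub i is Some j then (k (j : 'I_N))%:Z else 0) - N%:Z) N.
have szs : size s = N by rewrite size_mkseq.
have nths (i : 'I_N) : s`_i = (k i)%:Z - N%:Z by rewrite nth_mkseq // valK.
have ws : w s = p@_k.
  rewrite /w ifT.
    by congr (p@__); apply/mnmP => i; rewrite mnmE nths subrK.
  apply/(all_nthP 0) => i; rewrite szs => ltiN.
  by rewrite -[i in s`_i]/(val (Ordinal ltiN)) nths; lia.
have fw l : (size l <= N)%N -> (fun=> 0 : C^o) l = w (maya N l).
  move=> lN; rewrite /w; case: ifP => // _; rewrite -(p0 l lN).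
  by congr (p@__); apply/mnmP => i; rewrite mnmE -staircase_maya.
rewrite -ws -(@straighten_lift_at C C^o N w (fun=> 0) s aw cw szs fw).
by rewrite fglift_sum big1 // => l _; rewrite scaler0.
Qed.

Lemma alternant_tperm N (a : seq nat) (k : 'X_{1..N}) (i j : 'I_N) : i != j ->
  (alternant C N a)@_[multinom k (tperm i j x) | x < N] = - (alternant C N a)@_k.
Proof.
move=> neij; rewrite !mcoeff_alternant.
set A := \matrix_(i, j) _; set B := \matrix_(i, j) _.
have -> : A = row_perm (tperm i j) B by apply/matrixP => x y; rewrite !mxE mnmE.
by rewrite row_permE det_mulmx det_perm odd_tperm neij expr1 mulN1r.
Qed.

Lemma sym_mul_tperm N (p q : {mpoly C[N]}) : p \is symmetric ->
  (forall (k : 'X_{1..N}) (i j : 'I_N), i != j ->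
       q@_[multinom k (tperm i j x) | x < N] = - q@_k) ->
  (forall (k : 'X_{1..N}) (i j : 'I_N), i != j ->
       (p * q)@_[multinom k (tperm i j x) | x < N] = - (p * q)@_k).
Proof.
move=> /issymP sp anti k i j neij.
rewrite -mcoeff_sym msymM sp -mcoeffN; congr (_@__).
rewrite -mulrN; congr (_ * _); apply/mpolyP => m.
by rewrite mcoeff_sym anti // mcoeffN.
Qed.

End Alternants.

(** * Schur functions span the symmetric functions *)

Section SymmetricFunctions.

Variable C : numFieldType.
Implicit Types (f g : symfun C) (l k : intpart) (N : nat).

(** The monomial k, seen in one more variable. *)
Definition extend_mnm N (k : 'X_{1..N}) : 'X_{1..N.+1} :=
  [multinom if unlift ord_max i is Some j then k j else 0%N | i < N.+1].

Lemma mcoeff_last_var0 N (p : {mpoly C[N.+1]}) (k : 'X_{1..N}) :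
  (last_var0 p)@_k = p@_(extend_mnm k).
Proof.
rewrite /last_var0 comp_mpolyEX [in RHS](mpolyE p) !raddf_sum /=; apply: eq_bigr => m _.
rewrite !mcoeffZ comp_mpolyX mcoeffX; congr (_ * _).
rewrite big_ord_recr /= tnth_mktuple unlift_none.
under eq_bigr => i _.
  rewrite tnth_mktuple (_ : widen_ord _ i = fintype.lift ord_max i); last first.
    by apply: val_inj; rewrite /= /bump leqNgt ltn_ord add0n.
  rewrite fintype.liftK; over.
have -> : \prod_(i < N) 'X_i ^+ m (fintype.lift ord_max i) =
    'X_[[multinom m (fintype.lift ord_max i) | i < N]] :> {mpoly C[N]}.
  by rewrite [RHS](mpolyXE _ 1%g); apply: eq_bigr => i _; rewrite perm1 mnmE.
have [mmax|mmax] := posnP (m ord_max).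
  rewrite mmax expr0 mulr1 mcoeffX; congr (nat_of_bool _)%:R.
  apply/eqP/eqP => [<-|->].
    apply/mnmP => i; rewrite mnmE; case: unliftP => [j ->|->] //.
    by rewrite mnmE.
  by apply/mnmP => i; rewrite !mnmE fintype.liftK.
rewrite expr0n -[m ord_max == 0%N]negbK -lt0n mmax mulr0 mcoeff0.
case: eqP => // mE; move: mmax; rewrite mE mnmE unlift_none.
by rewrite ltnn.
Qed.

Lemma sf_symmetric f N : f N \is symmetric.
Proof. by case: f => f []. Qed.

Lemma sf_last_var0 f N : last_var0 (f N.+1) = f N.
Proof. by case: f => f []. Qed.

Lemma symfun_eq_large (N0 : nat) f g :
  (forall N, (N0 <= N)%N -> f N = g N) -> f = g.
Proof.
move=> eqfg; apply: symfun_ext => N.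
have [d] := ubnP (N0 - N)%N; elim: d N => // d IHd N; rewrite ltnS => led.
have [leN|ltN] := leqP N0 N; first exact: eqfg.
by rewrite -(sf_last_var0 f) -(sf_last_var0 g) IHd //; lia.
Qed.

(** A monomial of degree at most M in M + 1 variables misses a variable,
    which may be taken to be the last one by symmetry; its coefficient is
    then visible in M variables. *)
Lemma symfun_eq0_small (N : nat) f :
  (forall M, (N <= M)%N -> (msize (f M) <= N)%N) -> f N = 0 -> f = 0.
Proof.
move=> small fN0; apply: (@symfun_eq_large N) => M; elim: M => [|M IHM].
  by rewrite leqn0 => /eqP <-.
rewrite leq_eqVlt => /predU1P[<- //|]; rewrite ltnS => leNM.
apply/eqP; rewrite -msupp_eq0; case E: (msupp (f M.+1)) => [//|k ks].
have ksupp : k \in msupp (f M.+1) by rewrite E inE eqxx.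
have degk : (mdeg k < M.+1)%N.
  apply: leq_trans (msize_mdeg_lt ksupp) _.
  by apply: leq_trans (small _ (leqW leNM)) _; apply: leqW.
have [i ki] : exists i, k i = 0%N.
  apply: contrapT => no; move: degk; apply/negP; rewrite -leqNgt mdegE.
  apply: (@leq_trans (\sum_(x < M.+1) 1)%N); first by rewrite sum1_card card_ord.
  apply: leq_sum => i _.
  by rewrite lt0n; apply/eqP => ki; apply: no; exists i.
pose k' := [multinom k (tperm i ord_max x) | x < M.+1].
have k's : k' \in msupp (f M.+1) by rewrite /k' issym_msupp // sf_symmetric.
have k'E : k' = extend_mnm [multinom k' (fintype.lift ord_max x) | x < M].
  apply/mnmP => x; rewrite [RHS]mnmE; case: unliftP => [j ->|->]; first by rewrite mnmE.
  by rewrite mnmE tpermR.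
move: k's; rewrite mcoeff_msupp k'E -mcoeff_last_var0 sf_last_var0 IHM //.
by rewrite mcoeff0 eqxx.
Qed.

Lemma constant_termE f N : constant_term f = (f N)@_0%MM.
Proof.
elim: N => // N ->; rewrite -sf_last_var0 mcoeff_last_var0; congr (_@__).
by apply/mnmP => i; rewrite !mnmE; case: unliftP => [j|]; rewrite ?mnmE.
Qed.

Lemma constant_term_linear : linear (@constant_term C : symfun C -> C^o).
Proof. by move=> a f g; rewrite /constant_term /= mcoeffD mcoeffZ. Qed.

Section Schur.

Variable s : intpart -> symfun C.
Hypothesis hs : forall l, is_schur l (s l).

(** The degrees of a quotient of homogeneous polynomials subtract. *)
Lemma msize_schur N l : (size l <= N)%N -> (msize (s l N) <= (weight l).+1)%N.
Proof.
move=> lN; have [->|nz] := eqVneq (s l N) 0; first by rewrite msize0.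
have := congr1 (fun p => msize p) (hs lN).
rewrite msizeM //; last exact: (@alternant_neq0 _ _ empty_intpart).
rewrite (@msize_alternant _ N l) // (@msize_alternant _ N empty_intpart) //.
by rewrite (mdeg_staircase lN) addnS /= -addSn => /addIn/eq_leq.
Qed.

(** Compare coefficients at the staircase in s_l * alternant 0 = alternant
    l. All monomials of alternant 0 have the degree of the staircase, so
    only the constant term of s_l contributes on the left. *)
Lemma constant_term_schur l : constant_term (s l) = (l == empty_intpart)%:R.
Proof.
set N := size l; rewrite (constant_termE _ N).
rewrite -(@mcoeff_alternant_staircase C N l empty_intpart) // -(hs (leqnn _)).
set p := s l N; set q := alternant _ _ _; set d := staircase _ _.
have -> : p = (p@_0%MM)%:MP + (p - (p@_0%MM)%:MP) by rewrite addrC subrK.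
set p' := p - _.
have p'0 : p'@_0%MM = 0 by rewrite mcoeffB mcoeffC eqxx mulr1 subrr.
rewrite mcoeffD mcoeffC eqxx mulr1 p'0 addr0 mulrDl mcoeffD mcoeffCM.
rewrite (@mcoeff_alternant_staircase C N empty_intpart empty_intpart) // eqxx mulr1.
rewrite mcoeffM big1 ?addr0 // => -[k1 k2] /= /eqP dE.
have [k2s|] := boolP (bmnm k2 \in msupp q); last first.
  by rewrite mcoeff_msupp negbK => /eqP ->; rewrite mulr0.
have degk2 := mdeg_supp_alternant (l := empty_intpart) isT k2s.
have := congr1 (@mdeg N) dE; rewrite mdegD degk2 -[LHS]add0n => /addIn/esym/eqP.
by rewrite mdeg_eq0 => /eqP ->; rewrite p'0 mul0r.
Qed.

(** In d variables, with d larger than the degree of f, the product of f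
    with the Vandermonde determinant is antisymmetric, hence a combination
    of alternants. The same combination of Schur functions agrees with f in
    d variables, and both have degree below d, so they agree everywhere. *)
Lemma schur_span f : exists E : seq intpart, exists c : intpart -> C,
  f = \sum_(l <- E) c l *: s l.
Proof.
have [d fd] : exists d, forall N, (msize (f N) <= d)%N by case: f => f [].
(* L recovers a partition from the staircase of its alternant. *)
have /choice[L LP] (m : 'X_{1..d}) : exists y : intpart, forall l : intpart,
    (size l <= d)%N -> staircase d l = m -> y = l.
  have [[l [ld lm]]|no] := pselect (exists l : intpart, (size l <= d)%N /\ staircase d l = m).
    exists l => k kd km; apply/eqP/negPn/negP => nlk.
    have := mcoeff_alternant_staircase C ld kd; rewrite km -lm.
    rewrite mcoeff_alternant_staircase // eqxx (negPf nlk) => /eqP.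
    by rewrite oner_eq0.
  by exists empty_intpart => k kd km; case: no; exists k.
pose G := f d * alternant C d [::].
pose c (l : intpart) := G@_(staircase d l).
pose E := undup [seq l : intpart <- [seq L m | m <- msupp G] | (size l <= d)%N && (c l != 0)].
have memE (l : intpart) : (size l <= d)%N -> c l != 0 -> l \in E.
  move=> ld cl; rewrite mem_undup mem_filter ld cl; apply/mapP.
  by exists (staircase d l); [rewrite mcoeff_msupp | rewrite (LP _ _ ld)].
have szE (l : intpart) : l \in E -> (size l <= d)%N by rewrite mem_undup mem_filter => /andP[/andP[]].
have ltE (l : intpart) : l \in E -> (weight l < d)%N.
  rewrite mem_undup mem_filter => /andP[/andP[ld cl] _].
  have fn0 : f d != 0 by apply: contraNneq cl => f0; rewrite /c /G f0 mul0r mcoeff0.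
  have alt0 := @alternant_neq0 C d empty_intpart isT.
  have : (mdeg (staircase d l) < msize G)%N by apply: msize_mdeg_lt; rewrite mcoeff_msupp.
  rewrite /G (@msizeM _ _ (f d) (alternant C d empty_intpart) fn0 alt0).
  rewrite (@msize_alternant C d empty_intpart) // (mdeg_staircase ld) addnS /=.
  by rewrite ltn_add2r => /leq_trans; apply.
exists E, c; apply/eqP; rewrite -subr_eq0; apply/eqP.
set H := f - _.
have HE M : H M = f M - \sum_(l <- E) c l *: s l M.
  rewrite /H /=; congr (f M + _); rewrite scaleN1r; congr (- _).
  elim: (E) => [|l E' IHE]; first by rewrite !big_nil.
  by rewrite !big_cons /= IHE.
apply: (@symfun_eq0_small d) => [M leM|].
  rewrite HE; apply: leq_trans (mmeasureD_le _ _ _) _; rewrite geq_max fd /= mmeasureN.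
  rewrite big_seq; apply: leq_trans (mmeasure_sum _ _ _ _) _.
  apply/bigmax_leqP_seq => l lE _; apply: leq_trans (mmeasureZ_le _ _ _) _.
  by apply: leq_trans (msize_schur (leq_trans (szE _ lE) leM)) _; apply: ltE.
have alt0 := @alternant_neq0 C d empty_intpart isT.
apply/eqP; rewrite -(mulIr_eq0 _ (mulIf alt0)).
apply/eqP; apply: alternating_poly_eq0 => [|l ld].
  by apply: sym_mul_tperm (sf_symmetric _ _) _; apply: alternant_tperm.
rewrite HE mulrBl mulr_suml mcoeffB raddf_sum /=.
rewrite (eq_big_seq (fun k => c k * (k == l)%:R)) => [|k kE]; last first.
  by rewrite -scalerAl mcoeffZ (hs (szE _ kE)) mcoeff_alternant_staircase // szE.
have [lE|nlE] := boolP (l \in E).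
  rewrite (bigD1_seq l) ?undup_uniq //= eqxx mulr1 big1 ?addr0 ?subrr // => k /negPf ->.
  by rewrite mulr0.
rewrite big_seq big1 => [|k kE]; last first.
  by case: eqP => [kl|_]; [rewrite -kl kE in nlE | rewrite mulr0].
by rewrite subr0; apply/eqP; apply: contraNT nlE; apply: memE.
Qed.

End Schur.

End SymmetricFunctions.

(** * From symmetric functions to functionals *)

Section EnergyOfVertex.

Variable C : numFieldType.
Implicit Types (s : seq int) (l k : intpart).

(** The shift of all the entries by - m compensates the m new places, up to
    the prescribed sum of the tuple. *)
Lemma energy_phi_prefix m c (a : {ffun 'I_m -> int}) s : phi_tuples m c a ->
  energy [seq y - m%:Z | y <- phi_prefix a ++ s] = energy s - c * m%:Z.
Proof.
case=> _ sa; rewrite /energy size_phi_prefix_cat big_map big_split /=.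
rewrite big_const_seq count_predT size_cat size_phi_prefix iter_addr addr0 big_cat /=.
have -> : \sum_(y <- phi_prefix a) y = \sum_i a i.
  by rewrite big_map big_enum [RHS](reindex_inj rev_ord_inj); apply: eq_bigl.
rewrite sa big_split_ord /=.
have -> : \sum_(i < size s) (m + i).+1%:Z = \sum_(i < size s) (m%:Z + i.+1%:Z).
  by apply: eq_bigr => j _; lia.
rewrite big_split /= sumr_const card_ord.
(* The sum of the first m odd numbers. *)
have sq : \sum_(j < m) (j : nat)%:Z + \sum_(j < m) j.+1%:Z = m%:Z * m%:Z.
  elim: (m) => [|d IHd]; first by rewrite !big_ord0.
  by rewrite !big_ord_recr /= addrACA IHd; lia.
have -> : \sum_(j < m) j.+1%:Z = m%:Z * m%:Z - \sum_(j < m) (j : nat)%:Z.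
  by rewrite -sq addrC addKr.
rewrite mulrnDr !mulNrn -[m%:Z *+ m]mulr_natr natz; ring.
Qed.

Lemma vertex_linear_map (V V' : lmodType C) (h : {linear V -> V'}) (w : seq int -> V) m c s :
  wedge w -> vertex m c (h \o w) s = h (vertex m c w s).
Proof.
move=> ww; have [E EP] := @vertex_sum C m c (size s).
rewrite (EP _ _ _ (wedge_linear h ww)) // (EP _ _ _ ww) // raddf_sum.
by apply: eq_bigr.
Qed.

Lemma pairing_vertex (w : seq int -> C^o) m c s : wedge w ->
  pairing w (vertex m c (straighten C) s) = vertex m c w s.
Proof.
move=> ww; rewrite -(vertex_linear_map (pairing w) _ _ _ (straighten_wedge C)).
congr (vertex _ _ _ _); apply: funext => t; exact: pairing_straighten.
Qed.

(** The coefficient of l with values in the regular module, as a bundled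
    linear map. *)
Definition coefficient l : fock C -> C^o := fglift (fun k => (k == l)%:R : C^o).

HB.instance Definition _ l := GRing.Linear.copy (coefficient l)
  (fglift (fun k => (k == l)%:R : C^o) : fock C -> C^o).

Lemma weight_dom_vertex m c l k :
  coeff k (vertex m c (straighten C) (maya (size l) l)) != 0 ->
  (weight k)%:Z = (weight l)%:Z - c * m%:Z.
Proof.
rewrite -[coeff k _]/(coefficient k _).
rewrite -(vertex_linear_map (coefficient k) _ _ _ (straighten_wedge C)).
apply: contra_neqP => ne; rewrite /vertex; apply: fsbig1 => a pa.
apply/eqP; apply: contra_notT ne; rewrite /= -[coefficient k _]/(coeff k _).
have := energy_phi_prefix (maya (size l) l) pa; rewrite energy_maya // => <-.
case: straightenP => [k' szk' pk'|_]; last by rewrite coeff0 eqxx.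
rewrite coeffZ coeff_ket; case: (k' =P k) => [<- _|_]; last by rewrite mulr0 eqxx.
by rewrite (energy_perm pk') energy_maya.
Qed.

End EnergyOfVertex.

Section Interface.

Variable C : numFieldType.
Implicit Types (f g : symfun C) (l k : intpart) (t : seq int).

Variable s : intpart -> symfun C.
Hypothesis hs : forall l, is_schur l (s l).

Lemma sf_sum (I : Type) (r : seq I) (F : I -> symfun C) N :
  (\sum_(i <- r) F i : symfun C) N = \sum_(i <- r) F i N.
Proof. by elim: r => [|i r IHr]; rewrite ?big_nil // !big_cons /= IHr. Qed.

Lemma symfun_mul_linear (p : symfun C) : linear (fun f : symfun C => p * f).
Proof. by move=> a f g; apply: symfun_ext => N /=; rewrite mulrDr scalerAr. Qed.

Definition schur_of : fock C -> symfun C := fglift s.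

HB.instance Definition _ := GRing.Linear.copy schur_of (fglift s : fock C -> symfun C).

(** As straighten, with Schur functions in place of partitions. *)
Definition schur_functional t : symfun C := schur_of (straighten C t).

Lemma schur_functional_wedge : wedge schur_functional.
Proof. exact: (wedge_linear schur_of (straighten_wedge C)). Qed.

(** Both sides are alternating functions of the list that agree at the maya
    diagrams, by the definition of Schur functions. *)
Lemma schur_functional_bialternant N t : size t = N ->
  schur_functional t N * alternant C N [::] = bialternant C N t.
Proof.
move=> tN; rewrite -(@straighten_lift_at C {mpoly C[N]} N (@bialternant C N)
  (fun l => s l N * alternant C N [::]) t) //.
- rewrite /schur_functional /schur_of !fglift_sum sf_sum mulr_suml.
  by apply: eq_bigr => l _; rewrite /= scalerAl.
- exact: bialternant_alternating.
- exact: bialternant_clipped.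
by move=> l lN; rewrite bialternant_maya hs.
Qed.

(** Any sufficiently long initial segment of the maya diagram can be used to
    compute raise. *)
Lemma maya_raise_extend (V : lmodType C) r N (w : seq int -> V) l : (0 < r)%N -> wedge w ->
  (size l + r <= N)%N -> shift_each r%:Z w (maya N l) = raise r w (maya (size l) l).
Proof.
move=> r0 ww leN; rewrite -(raise_extend (N - (size l + r)) _ r0 ww) size_maya maya_tail //.
by rewrite addnA subnKC.
Qed.

(** The Murnaghan-Nakayama rule. Both sides agree in all large numbers of
    variables after multiplication by the Vandermonde determinant, which can
    be cancelled. *)
Lemma power_sum_schur r l : (0 < r)%N ->
  power_sum C r * s l = raise r schur_functional (maya (size l) l).
Proof.
move=> r0; apply: (@symfun_eq_large _ (size l + r)) => N leN.
have lN : (size l <= N)%N by apply: leq_trans leN; apply: leq_addr.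
rewrite -(maya_raise_extend r0 schur_functional_wedge leN) shift_each_index sf_sum size_maya.
have alt0 : alternant C N [::] != 0 := @alternant_neq0 C N empty_intpart isT.
have -> : (power_sum C r * s l : symfun C) N = (\sum_(i < N) 'X_i ^+ r) * s l N.
  transitivity (((\sum_(i < N) 'X_i ^+ r) *+ (0 < r)%N) * s l N); first by [].
  by rewrite r0 mulr1n.
apply: (mulIf alt0); rewrite -mulrA (hs lN) -bialternant_maya power_sum_bialternant; last 2 first.
- exact: size_maya.
- by apply/allP => x /maya_ge.
rewrite shift_each_index size_maya mulr_suml; apply: eq_bigr => i _.
rewrite schur_functional_bialternant // size_set_nth size_maya.
exact/maxn_idPr/ltn_ord.
Qed.

Variable hall : symfun C -> symfun C -> C.
Hypothesis hhall : is_hall_product s hall.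

Lemma hall_schur_of l (v : fock C) : hall (s l) (schur_of v) = coeff l v.
Proof.
have [_ lin orth] := hhall; rewrite /schur_of.
rewrite (linear_fglift (h := hall (s l) : symfun C -> C^o)) //.
by rewrite (_ : _ \o s = fun k => (k == l)%:R) //; apply: funext => k; rewrite /= orth eq_sym.
Qed.

Lemma hall_schur_ofl l (v : fock C) : hall (schur_of v) (s l) = coeff l v.
Proof.
have [lin _ orth] := hhall; rewrite /schur_of.
rewrite (linear_fglift (h := hall^~ (s l) : symfun C -> C^o)) //.
by rewrite (_ : _ \o s = fun k => (k == l)%:R) //; apply: funext => k; rewrite /= orth.
Qed.

Lemma schur_of_surj g : exists v : fock C, g = schur_of v.
Proof.
have [E [c ->]] := schur_span hs g; exists (\sum_(l <- E) c l *: ket C l).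
by rewrite linear_sum; apply: eq_bigr => l _; rewrite linearZ /= [schur_of _]fglift_ket.
Qed.

(** The Schur functions span and are orthonormal. *)
Lemma hall_nondegenerate f g : (forall l, hall (s l) f = hall (s l) g) -> f = g.
Proof.
have [u ->] := schur_of_surj f; have [v ->] := schur_of_surj g => eqh.
congr schur_of; apply/eqP/freeg_eqP => l.
by rewrite -!hall_schur_of.
Qed.

Variable pperp : nat -> symfun C -> symfun C.
Hypothesis hpperp : forall r, is_adjoint hall (fun f => power_sum C r * f) (pperp r).

Lemma shift_each_schur_functional c t :
  shift_each c schur_functional t = schur_of (shift_each c (straighten C) t).
Proof. by rewrite !shift_each_index linear_sum. Qed.

(** Lowering satisfies the equations that define the adjoint of
    multiplication by p_r, by coeff_shift_adjoint. *)
Lemma pperp_schur r k : (0 < r)%N ->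
  pperp r (s k) = lower r schur_functional (maya (size k) k).
Proof.
move=> r0; apply: hall_nondegenerate => l.
rewrite -hpperp power_sum_schur //.
pose M := maxn (size k) (size l + r).
have kM : (size k <= M)%N by apply: leq_maxl.
have lrM : (size l + r <= M)%N by apply: leq_maxr.
have lM : (size l <= M)%N by apply: leq_trans lrM; apply: leq_addr.
have sww := schur_functional_wedge.
rewrite -(maya_raise_extend r0 sww lrM).
rewrite -(wedge_maya (wedge_stable (lower_wedge r0 sww)) kM).
rewrite /lower !shift_each_schur_functional hall_schur_of hall_schur_ofl.
by rewrite (coeff_shift_adjoint C (- r%:Z) kM lM) opprK.
Qed.

Lemma pperp_linear r : linear (pperp r).
Proof.
have [_ lin _] := hhall.
move=> a f g; apply: hall_nondegenerate => l.
by rewrite -hpperp lin [RHS]lin -!hpperp.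
Qed.

(** Generalized from the constant term to any th that agrees with w on Schur
    functions, for the induction on mu: the outermost operator is absorbed
    into th. *)
Lemma functional_brauer_operator (th : symfun C -> C^o) (w : seq int -> C^o) (mu : seq nat) l :
    linear th -> wedge w -> all (leq 1) mu ->
    (forall k, th (s k) = w (maya (size k) k)) ->
  th (foldr (brauer_operator pperp) (s l) mu) = brauer_functional w mu (maya (size l) l).
Proof.
elim: mu th w => [|r mu IHmu] th w lth ww //= /andP[r0 mu0] thw.
have lt := linear_DZ lth; have lp := linear_DZ (pperp_linear r).
rewrite (IHmu (fun f => th (brauer_operator pperp r f)) (brauer_dual r w)) //.
- move=> a f g; rewrite -lth; congr th.
  rewrite /brauer_operator symfun_mul_linear lp.1 lp.2 scalerDr !scalerDr.
  rewrite [eps r *: (a *: f)]scalerA [eps r * a]mulrC -scalerA.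
  by rewrite [X in X + _ = _]addrACA [LHS]addrACA.
- exact: brauer_dual_wedge.
move=> k; rewrite /brauer_operator !lt.1 lt.2 power_sum_schur // pperp_schur //.
have th_schur : th \o schur_functional = w.
  apply: funext => t; rewrite -(pairing_straighten t ww) /pairing /=.
  by rewrite /schur_functional /schur_of linear_fglift //; congr (fglift _ _); apply: funext.
have th_shift c t : th (shift_each c schur_functional t) = shift_each c w t.
  by rewrite linear_shift_each // th_schur.
by rewrite /brauer_dual !fctE thw /raise /lower !th_shift.
Qed.

Lemma constant_term_brauer (mu : seq nat) l : all (leq 1) mu ->
  constant_term (foldr (brauer_operator pperp) (s l) mu) =
  brauer_functional (vacuum C) mu (maya (size l) l).
Proof.
move=> mu0; apply: functional_brauer_operator => //.
- exact: constant_term_linear.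
- exact: vacuum_wedge.
by move=> k; rewrite constant_term_schur // vacuum_maya.
Qed.

End Interface.

(** * The character recursion *)

Section CharacterExtension.

Variable C : numFieldType.
Implicit Types (l k : intpart).

Lemma ratfun_const_sum (I : Type) (r : seq I) (P : pred I) (F : I -> C) :
  ratfun_const (\sum_(i <- r | P i) F i) = \sum_(i <- r | P i) ratfun_const (F i).
Proof. by rewrite /ratfun_const !rmorph_sum. Qed.

Lemma ratfun_constM (a b : C) : ratfun_const (a * b) = ratfun_const a * ratfun_const b.
Proof. by rewrite /ratfun_const !rmorphM. Qed.

(** The convention that the character of a partition of large weight is 0 is
    consistent with the Frobenius-type formula, since the functional w
    vanishes there. *)
Lemma chi_ext_pairing n (chi : intpart -> brauer C n -> ratfun C) (f : brauer C n)
    (w : seq int -> C^o) (v : fock C) :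
    (forall k, coeff k v != 0 -> (weight k <= n)%N ->
       chi k f = ratfun_const (w (maya (size k) k))) ->
    (forall k, (n < weight k)%N -> w (maya (size k) k) = 0) ->
  chi_ext chi v f = ratfun_const (pairing w v).
Proof.
move=> chiE w0; rewrite /chi_ext /pairing fglift_sum ratfun_const_sum.
rewrite big_mkcond [LHS]big_seq [RHS]big_seq; apply: eq_bigr => k kv.
case: ifPn => [kn|]; last by rewrite -ltnNge => /w0 ->; rewrite scaler0 /ratfun_const !rmorph0.
by rewrite chiE ?ratfun_constM // -mem_dom.
Qed.

Lemma pairing_phi (w : seq int -> C^o) m c l : wedge w ->
  pairing w (phi m c (ket C l)) = vertex m c w (maya (size l) l).
Proof. by move=> ww; rewrite /phi fglift_ket -(pairing_vertex _ _ _ ww). Qed.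

Lemma weight_phi m c l k : coeff k (phi m c (ket C l)) != 0 ->
  (weight k)%:Z = (weight l)%:Z - c * m%:Z.
Proof. by rewrite /phi fglift_ket; apply: weight_dom_vertex. Qed.

Lemma intpart_all_pos l : all (leq 1) l.
Proof.
case: l => l /= /andP[_ l0]; apply/allP => x xl; rewrite lt0n.
by apply: contra l0 => /eqP <-.
Qed.

(** The two choices of phi differ only in v. In both cases the terms of the
    argument are labels of characters: phi_1 lowers the weight by m, and v
    preserves it but is nonzero only for even m. *)
Lemma brauer_character_recursion (s : intpart -> symfun C)
  (hs : forall l, is_schur l (s l))
  (hall : symfun C -> symfun C -> C)
  (hhall : is_hall_product s hall)
  (pperp : nat -> symfun C -> symfun C)
  (hpperp : forall r, is_adjoint hall (fun f => power_sum C r * f) (pperp r))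
  (chi : forall n, intpart -> brauer C n -> ratfun C)
  (hram : forall n, ram_formula s pperp (chi n))
  (m n : nat) (hm : (1 <= m)%N) (hmn : (m <= n)%N)
  (l : intpart) (i : nat) (hi : (i <= n./2)%N)
  (hl : weight l = (n - i.*2)%N)
  (mu : intpart) (hmu : weight mu = (n - m)%N)
  (hdiv : all (fun r => ~~ (m %| r)%N) mu)
  (w : 'S_n) (hw : has_cycle_type w (rcons mu m))
  (w' : 'S_(n - m)) (hw' : has_cycle_type w' mu)
  (v : fock C) :
    v = eps m *: ket C l \/ v = eps m *: phi m 0 (ket C l) ->
  chi n l (brauer_perm C w) =
    chi_ext (chi (n - m)%N) (- phi m 1 (ket C l) + v) (brauer_perm C w').
Proof.
move=> vE.
have mu0 := intpart_all_pos mu; have vw := vacuum_wedge C.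
have [nu pnu] : exists nu : intpart, perm_eq nu (rcons mu m).
  have srt : sorted geq (sort geq (rcons mu m)).
    by apply: sort_sorted => a b; apply: leq_total.
  have nu0 : 0%N \notin sort geq (rcons mu m).
    rewrite mem_sort mem_rcons inE negb_or eq_sym -lt0n hm.
    by apply/negP => /(allP mu0).
  have hnu : sorted geq (sort geq (rcons mu m)) && (0%N \notin sort geq (rcons mu m)).
    by rewrite srt.
  by exists (IntPart hnu); rewrite /= perm_sort.
have lab : brauer_label n l by exists i.
have cyc : has_cycle_type w nu by apply: perm_trans hw _; rewrite perm_sym.
(* nu lists the parts of mu and the part m in decreasing order, as required
   of a partition. *)
rewrite (hram n l nu w lab cyc).
rewrite (constant_term_brauer hs hhall hpperp) ?intpart_all_pos //.
have [recur phi0] := brauer_functional_recursion C hm mu0 hdiv pnu.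
set u := brauer_functional _ mu in recur phi0.
have wu : wedge u by apply: brauer_functional_wedge.
rewrite recur.
rewrite (@chi_ext_pairing _ _ _ u); first last.
- move=> k ltk; apply: (brauer_functional_below (d := 0)); first exact: vacuum_below.
  by rewrite energy_maya // add0r -/(weight mu) hmu.
- move=> k ck kn; rewrite (hram _ _ _ _ _ hw').
    by rewrite (constant_term_brauer hs hhall hpperp) ?intpart_all_pos.
  have wk : coeff k (phi m 1 (ket C l)) != 0 \/
      ~~ odd m /\ (weight k = weight l).
    have [ck1|ck1] := eqVneq (coeff k (phi m 1 (ket C l))) 0; last by left.
    right; move: ck; rewrite coeffD coeffN ck1 oppr0 add0r.
    case: vE => ->; rewrite coeffZ mulf_eq0 negb_or /eps => /andP[+ ckl].
      case: (odd m); rewrite ?eqxx // => _; split=> //.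
      by move: ckl; rewrite coeff_ket; case: (l =P k) => [->|]; rewrite ?eqxx.
    case: (odd m); rewrite ?eqxx // => _; split=> //.
    by have := weight_phi ckl; rewrite mul0r subr0 => -[].
  case: wk => [/weight_phi wk|[mev wk]]; rewrite hl in wk.
    by exists i; lia.
  by exists (i - m./2)%N; lia.
congr ratfun_const; rewrite linearD linearN /= pairing_phi // addrC !fctE; congr (_ + _).
by case: vE => ->; rewrite linearZ /= ?pairing_phi // -?phi0 // /pairing fglift_ket.
Qed.

End CharacterExtension.

Theorem theorem5p2 (R : realType)
  (s : intpart -> symfun R[i])
  (hs : forall l, is_schur l (s l))
  (hall : symfun R[i] -> symfun R[i] -> R[i])
  (hhall : is_hall_product s hall)
  (pperp : nat -> symfun R[i] -> symfun R[i])
  (hpperp : forall r, is_adjoint hall (fun f => power_sum R[i] r * f) (pperp r))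
  (chi : forall n, intpart -> brauer R[i] n -> ratfun R[i])
  (hchi : forall n, irreducible_labelling (chi n))
  (hram : forall n, ram_formula s pperp (chi n))
  (m n : nat) (hm : (1 <= m)%N) (hmn : (m <= n)%N)
  (l : intpart) (i : nat) (hi : (i <= n./2)%N)
  (hl : weight l = (n - i.*2)%N)
  (mu : intpart) (hmu : weight mu = (n - m)%N)
  (hdiv : all (fun r => ~~ (m %| r)%N) mu)
  (w : 'S_n) (hw : has_cycle_type w (rcons mu m))
  (w' : 'S_(n - m)) (hw' : has_cycle_type w' mu) :
  chi n l (brauer_perm R[i] w) =
    chi_ext (chi (n - m)%N)
      (- phi m 1 (ket R[i] l) + eps m *: ket R[i] l)
      (brauer_perm R[i] w')
  /\
  chi n l (brauer_perm R[i] w) =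
    chi_ext (chi (n - m)%N)
      (- phi m 1 (ket R[i] l) + eps m *: phi m 0 (ket R[i] l))
      (brauer_perm R[i] w').
Proof.
have recur := brauer_character_recursion hs hhall hpperp hram hm hmn hi hl hmu hdiv hw hw'.
by split; apply: recur; [left | right].
Qed.
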